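(* Let $R$ be a commutative algebra, let $B=R_{\mathbf p}(\mathbf t,\boldsymbol\sigma,\mathbf H,\mathbf J)$ be a BR algebra of rank $n$ over $R$, let $\mathcal O\in\operatorname{Maxspec}(R)/\mathbb Z^n$ be a torsion-free orbit, and for each $i\in[n]$ let $\beta_i\subseteq\mathcal O$ be the set of $i$-breaks in $\mathcal O$. Then the isomorphism classes of simple modules in $(B,R)\text{-wmod}_{\mathcal O}$ are in bijection with the set $\prod_{i=1}^n\overline\beta_i'$: a simple module $M\in(B,R)\text{-wmod}_{\mathcal O}$ corresponds to the unique $n$-tuple $([\mathfrak n_1],\dots,[\mathfrak n_n])\in\prod_{i=1}^n\overline\beta_i'$ such that $$\operatorname{supp}(M)=\{\mathfrak m\in\mathcal O\mid[\mathfrak n_i]^-\prec_i\mathfrak m\preceq_i[\mathfrak n_i]\text{ for all }i=1,\dots,n\}.$$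
   Context: All algebras are associative unital algebras over a field $\Bbbk$; modules are left modules; $[n]=\{1,\dots,n\}$. A matrix $\mathbf p=(p_{ik})\in M_n(\Bbbk^\times)$ is multiplicatively antisymmetric if $p_{ik}=p_{ki}^{-1}$. BR algebra: given commuting automorphisms $\boldsymbol\sigma=(\sigma_1,\dots,\sigma_n)$ of $R$ and multiplicatively antisymmetric $\mathbf p$, let $R_{\mathbf p}[\mathbf t^{\pm1};\boldsymbol\sigma]$ be generated over $R$ by $t_1^{\pm1},\dots,t_n^{\pm1}$ with $t_i^{\pm1}r=\sigma_i^{\pm1}(r)t_i^{\pm1}$ and $t_kt_i=p_{ik}t_it_k$ for $i\ne k$. Let $\mathbf H=(H_1,\dots,H_n)$, $\mathbf J=(J_1,\dots,J_n)$ be ideals of $R$. Put $I_i^{(k)}=J_i\sigma_i(J_i)\cdots\sigma_i^{k-1}(J_i)$ for $k>0$, $I_i^{(0)}=R$, $I_i^{(k)}=\sigma_i^{-1}(H_i)\cdots\sigma_i^{k}(H_i)$ for $k<0$. Assume that $\sigma_i(H_k)=H_k$, $\sigma_i(J_k)=J_k$, $H_iH_k=H_kH_i$, $H_iJ_k=J_kH_i$, $J_iJ_k=J_kJ_i$ for $i\ne k$, and $I_i^{(k)}\neq0$ for all $i,k$. Then $B=\bigoplus_{\boldsymbol\alpha\in\mathbb Z^n}B_{\boldsymbol\alpha}\subset R_{\mathbf p}[\mathbf t^{\pm1};\boldsymbol\sigma]$ with $B_{\boldsymbol\alpha}=I_1^{(\alpha_1)}\cdots I_n^{(\alpha_n)}t_1^{\alpha_1}\cdots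 t_n^{\alpha_n}$; in particular $B_{\mathbf 0}=R$. Orbits and weight modules: $\mathbb Z^n$ acts on $\operatorname{Maxspec}(R)$ by $\boldsymbol\alpha\cdot\mathfrak m=\boldsymbol\sigma^{\boldsymbol\alpha}(\mathfrak m)=\sigma_1^{\alpha_1}\cdots\sigma_n^{\alpha_n}(\mathfrak m)$. An orbit $\mathcal O$ is torsion-free if for $\mathfrak m\in\mathcal O$, $\boldsymbol\sigma^{\boldsymbol\alpha}(\mathfrak m)=\mathfrak m$ implies $\boldsymbol\alpha=\mathbf 0$. A $B$-module $M$ is a weight module if $M=\bigoplus_{\mathfrak m\in\operatorname{Maxspec}(R)}M_{\mathfrak m}$ with $M_{\mathfrak m}=\{v\in M:\mathfrak m v=0\}$; $\operatorname{supp}(M)=\{\mathfrak m:M_{\mathfrak m}\ne0\}$. $(B,R)\text{-wmod}_{\mathcal O}$ is the category of weight modules $M$ with $\operatorname{supp}(M)\subseteq\mathcal O$ (a full subcategory of $B$-modules). Breaks: $\mathfrak m\in\operatorname{Maxspec}(R)$ is an $i$-break if $\sigma_i(\mathfrak m)\supseteq H_iJ_i$. If $\mathfrak m$ is an $i$-break then so is $\sigma_k^{\pm1}(\mathfrak m)$ for $k\ne i$, so $\Gamma_i=\langle\sigma_k:k\neq i\rangle$ acts on $\beta_i$; put $\overline\beta_i=\beta_i/\Gamma_i$. Let $\prec_i$ be the strict partial order on $\mathcal O$ generated by $\mathfrak m\prec_i\sigma_i(\mathfrak m)$ (well defined since $\mathcal O$ is torsion-free), with $\preceq_i$ the associated non-strict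 order. It induces a total order on $\overline\beta_i$: $[\mathfrak m]\prec_i[\mathfrak n]$ iff there are $\gamma_1,\gamma_2\in\Gamma_i$ with $\gamma_1(\mathfrak m)\prec_i\gamma_2(\mathfrak n)$. Define $\overline\beta_i'=\{\infty_i\}$ if $\overline\beta_i=\emptyset$; $\overline\beta_i'=\overline\beta_i\cup\{\infty_i\}$ if $\overline\beta_i$ has a maximal element; and $\overline\beta_i'=\overline\beta_i$ otherwise. Here $\infty_i$ is larger than all elements of $\overline\beta_i$. For $[\mathfrak n]\in\overline\beta_i'$, $[\mathfrak n]^-$ is the largest element of $\overline\beta_i'$ that is $\prec_i[\mathfrak n]$, or $[\mathfrak n]^-=-\infty_i$ if $[\mathfrak n]$ is the minimal element. For $\mathfrak m\in\mathcal O$ we have $-\infty_i\prec_i\mathfrak m\prec_i\infty_i$, and for $[\mathfrak n]\in\overline\beta_i$ we write $\mathfrak m\preceq_i[\mathfrak n]$ (resp. $[\mathfrak n]\prec_i\mathfrak m$, etc.) if there is $\gamma\in\Gamma_i$ with $\mathfrak m\preceq_i\gamma(\mathfrak n)$ (resp. $\gamma(\mathfrak n)\prec_i\mathfrak m$, etc.). *)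

(* Defs.v *)
From HB Require Import structures.
From Stdlib Require Import Relation_Operators.
From mathcomp Require Import all_boot all_order all_algebra.
From mathcomp Require Import finmap monalg boolp classical_sets.
Set Implicit Arguments.
Unset Strict Implicit.
Unset Printing Implicit Defensive.
Import GRing.Theory.
Local Open Scope classical_set_scope.
Local Open Scope ring_scope.

Notation multideg n := {ffun 'I_n -> int}.

Section Ideals.
Variable R : comNzRingType.
Implicit Types I J : set R.

(* Unlike [idealr_closed], this allows the unit ideal. *)
Definition ideal I :=
  [/\ I 0, forall x y, I x -> I y -> I (x + y) & forall a x, I x -> I (a * x)].

Definition ideal_mul I J : set R :=
  [set x | exists2 s : seq (R * R),
     forall u, u \in s -> I u.1 /\ J u.2 & x = \sum_(u <- s) u.1 * u.2].

Definition maximal_ideal I :=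
  [/\ ideal I, ~ I 1 & forall J, ideal J -> ~ J 1 -> I `<=` J -> J = I].

Lemma idealT : ideal setT. Proof. by []. Qed.

Lemma ideal_mul_ideal I J : ideal I -> ideal (ideal_mul I J).
Proof.
move=> [I0 ID IM]; split.
- by exists [::] => //; rewrite big_nil.
- move=> x y [s sIJ ->] [s' s'IJ ->]; exists (s ++ s'); last by rewrite big_cat.
  by move=> u; rewrite mem_cat => /orP[/sIJ|/s'IJ].
- move=> a x [s sIJ ->]; exists [seq (a * u.1, u.2) | u <- s].
    by move=> _ /mapP[u /sIJ[Iu Ju] ->]; split=> //=; apply: IM.
  by rewrite big_map mulr_sumr; apply: eq_bigr => u _; rewrite mulrA.
Qed.

Lemma ideal_mulP I J x y : I x -> J y -> ideal_mul I J (x * y).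
Proof.
move=> Ix Jy; exists [:: (x, y)]; last by rewrite big_seq1.
by move=> u; rewrite inE => /eqP ->.
Qed.

Lemma ideal_mul_min I J (K : set R) : K 0 ->
  (forall x y, K x -> K y -> K (x + y)) ->
  (forall x y, I x -> J y -> K (x * y)) -> ideal_mul I J `<=` K.
Proof.
move=> K0 KD KM _ [s sIJ ->]; rewrite big_seq.
by elim/big_ind: _ => // u /sIJ[Iu Ju]; apply: KM.
Qed.

Definition ideal_prod (s : seq (set R)) : set R :=
  \big[ideal_mul/setT]_(I <- s) I.

Lemma ideal_prod_ideal s : (forall I, I \in s -> ideal I) ->
  ideal (ideal_prod s).
Proof.
rewrite /ideal_prod; elim: s => [|I s IHs] sP; first by rewrite big_nil.
by rewrite big_cons; apply: ideal_mul_ideal; apply: sP; rewrite inE eqxx.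
Qed.

Lemma ideal_prod_cat s1 s2 x y :
    (forall I, I \in s2 -> ideal I) ->
  ideal_prod s1 x -> ideal_prod s2 y -> ideal_prod (s1 ++ s2) (x * y).
Proof.
move=> s2P s1x s2y; elim: s1 x s1x => [|I s1 IHs] x.
  by move=> _; have [_ _] := ideal_prod_ideal s2P; apply.
rewrite /ideal_prod /= !big_cons -/(ideal_prod _) -/(ideal_prod (_ ++ _)).
move: x; apply: ideal_mul_min => [|x x' xP x'P|a b Ia s1b] /=.
- by exists [::] => //; rewrite big_nil mul0r.
- rewrite mulrDl; case: xP => s sP ->; case: x'P => s' s'P ->.
  exists (s ++ s'); last by rewrite big_cat.
  by move=> u; rewrite mem_cat => /orP[/sP|/s'P].
- by rewrite -mulrA; apply: ideal_mulP => //; apply: IHs.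
Qed.

Lemma ideal_prod_catl s1 s2 :
    (forall I, I \in s1 -> ideal I) ->
  ideal_prod (s1 ++ s2) `<=` ideal_prod s1.
Proof.
elim: s1 => [|I s1 IHs] sP; first by rewrite /ideal_prod big_nil.
have [p0 pD pM] : ideal (ideal_prod (I :: s1)) by apply: ideal_prod_ideal.
rewrite /= [X in X `<=` _]/ideal_prod big_cons.
apply: ideal_mul_min => // x y Ix s12y.
rewrite /ideal_prod big_cons; apply: ideal_mulP => //; apply: IHs => //.
by move=> J sJ; apply: sP; rewrite inE sJ orbT.
Qed.

Lemma ideal_prod_catr s1 s2 :
    (forall I, I \in s2 -> ideal I) ->
  ideal_prod (s1 ++ s2) `<=` ideal_prod s2.
Proof.
move=> sP; have [p0 pD pM] := ideal_prod_ideal sP.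
elim: s1 => [//|I s1 IHs].
rewrite /= [X in X `<=` _]/ideal_prod big_cons.
by apply: ideal_mul_min => // x y Ix /IHs; apply: pM.
Qed.

Lemma ideal_prod_image (f : {rmorphism R -> R}) s x :
  ideal_prod s x -> ideal_prod [seq f @` (A : set R) | A <- s] (f x).
Proof.
rewrite /ideal_prod; elim: s x => [|I s IHs] x; first by rewrite !big_nil.
rewrite /= !big_cons => -[t tP ->]; rewrite rmorph_sum.
exists [seq (f u.1, f u.2) | u <- t].
  move=> _ /mapP[u /tP[Iu su] ->] /=; split; first by exists u.1.
  exact: IHs.
by rewrite big_map; apply: eq_bigr => u _; rewrite rmorphM.
Qed.

End Ideals.

Section SkewLaurent.
Variables (k : fieldType) (R : comAlgType k) (n : nat).

Record skewDatum := SkewDatum {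
  sd_p : 'M[k]_n;
  sd_sigma : 'I_n -> {lrmorphism R -> R};
  sd_sigmaV : 'I_n -> R -> R;
  sd_p_neq0 : forall i j, sd_p i j != 0;
  sd_p_antisym : forall i j, sd_p i j = (sd_p j i)^-1;
  sd_sigmaK : forall i, cancel (sd_sigma i) (sd_sigmaV i);
  sd_sigmaVK : forall i, cancel (sd_sigmaV i) (sd_sigma i);
  sd_sigmaC : forall i j r,
    sd_sigma i (sd_sigma j r) = sd_sigma j (sd_sigma i r) }.

Variable D : skewDatum.
Local Notation p := (sd_p D).
Local Notation sigma := (sd_sigma D).
Local Notation sigmaV := (sd_sigmaV D).
Implicit Types (i j : 'I_n) (z : int) (a b c : multideg n).

Definition sigmaz i z (r : R) : R :=
  match z with Posz m => iter m (sigma i) r | Negz m => iter m.+1 (sigmaV i) r end.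

(* sigma_1^(a_1) (sigma_2^(a_2) (... (sigma_n^(a_n) r))) *)
Definition sigmaX a (r : R) : R :=
  foldr (fun i => sigmaz i (a i)) r (enum 'I_n).

(* Scalar such that t^a t^b = skew_coef a b t^(a + b): reordering
   t_1^(a_1)..t_n^(a_n) t_1^(b_1)..t_n^(b_n) moves t_k^(a_k) past t_i^(b_i) for
   every i < k, each time at the cost of p_ik^(a_k b_i). *)
Definition skew_coef a b : k :=
  \prod_(j < n) \prod_(i < n | (i < j)%N) p i j ^ (a j * b i).

Fact sigmaVC i j r : sigmaV i (sigmaV j r) = sigmaV j (sigmaV i r).
Proof.
by rewrite -[LHS](sd_sigmaK D j) -[X in sigmaV j X](sd_sigmaK D i)
  -sd_sigmaC !sd_sigmaVK.
Qed.

Fact sigmaVCs i j r : sigmaV i (sigma j r) = sigma j (sigmaV i r).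
Proof. by rewrite -[RHS](sd_sigmaK D i) sd_sigmaC sd_sigmaVK. Qed.

Fact sigmaz0 i r : sigmaz i 0 r = r. Proof. by []. Qed.

Fact sigmazS i z r : sigmaz i (z + 1) r = sigma i (sigmaz i z r).
Proof.
case: z => [m|[|m]].
- by rewrite -[1]/(Posz 1) -PoszD addn1.
- by rewrite NegzE addNr /= sd_sigmaVK.
- have -> : Negz m.+1 + 1 = Negz m.
    by rewrite !NegzE -[m.+2]addn1 PoszD opprD addrNK.
  by rewrite /= sd_sigmaVK.
Qed.

Fact sigmazB i z r : sigmaz i (z - 1) r = sigmaV i (sigmaz i z r).
Proof. by rewrite -[in RHS](subrK 1 z) sigmazS sd_sigmaK. Qed.

Fact sigmazD i z w r : sigmaz i (z + w) r = sigmaz i z (sigmaz i w r).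
Proof.
elim: z => [|m IH|m IH]; first by rewrite add0r.
- by rewrite -addn1 PoszD addrAC !sigmazS IH.
- by rewrite -addn1 PoszD opprD addrAC !sigmazB IH.
Qed.

Fact sigmazCs i j z r : sigmaz i z (sigma j r) = sigma j (sigmaz i z r).
Proof.
elim: z => [|m IH|m IH] //.
- by rewrite -addn1 PoszD !sigmazS IH sd_sigmaC.
- by rewrite -addn1 PoszD opprD !sigmazB IH sigmaVCs.
Qed.

Fact sigmazC i j z w r :
  sigmaz i z (sigmaz j w r) = sigmaz j w (sigmaz i z r).
Proof.
elim: w => [|m IH|m IH] //.
- by rewrite -addn1 PoszD !sigmazS sigmazCs IH.
- by rewrite -addn1 PoszD opprD !sigmazB -IH -[LHS](sd_sigmaK D j)
    -sigmazCs sd_sigmaVK.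
Qed.

Fact sigmaV_is_zmod_morphism i : zmod_morphism (sigmaV i).
Proof.
by move=> x y; rewrite -[RHS](sd_sigmaK D i) rmorphB /= !sd_sigmaVK.
Qed.

Fact sigmaV_is_monoid_morphism i : monoid_morphism (sigmaV i).
Proof.
split=> [|x y]; first by rewrite -[RHS](sd_sigmaK D i) rmorph1.
by rewrite -[RHS](sd_sigmaK D i) rmorphM /= !sd_sigmaVK.
Qed.

Fact sigmaV_is_scalable i : scalable (sigmaV i).
Proof.
by move=> u x; rewrite -[RHS](sd_sigmaK D i) linearZ /= sd_sigmaVK.
Qed.

Fact sigmaz_is_zmod_morphism i z : zmod_morphism (sigmaz i z).
Proof.
move=> x y; elim: z => [|m IH|m IH] //.
- by rewrite -addn1 PoszD !sigmazS IH rmorphB.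
- by rewrite -addn1 PoszD opprD !sigmazB IH sigmaV_is_zmod_morphism.
Qed.

Fact sigmaz_is_monoid_morphism i z : monoid_morphism (sigmaz i z).
Proof.
split=> [|x y]; elim: z => [|m IH|m IH] //;
  rewrite -addn1 PoszD ?opprD !(sigmazS, sigmazB) ?IH ?rmorph1 ?rmorphM //;
  by case: (sigmaV_is_monoid_morphism i).
Qed.

Fact sigmaz_is_scalable i z : scalable (sigmaz i z).
Proof.
move=> u x; elim: z => [|m IH|m IH] //.
- by rewrite -addn1 PoszD !sigmazS IH linearZ.
- by rewrite -addn1 PoszD opprD !sigmazB IH sigmaV_is_scalable.
Qed.

HB.instance Definition _ i z := GRing.isZmodMorphism.Build R R (sigmaz i z)
  (sigmaz_is_zmod_morphism i z).
HB.instance Definition _ i z := GRing.isMonoidMorphism.Build R R (sigmaz i z)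
  (sigmaz_is_monoid_morphism i z).
HB.instance Definition _ i z := GRing.isScalable.Build k R R *:%R (sigmaz i z)
  (sigmaz_is_scalable i z).

Fact sigmaX_is_zmod_morphism a : zmod_morphism (sigmaX a).
Proof.
by move=> x y; rewrite /sigmaX; elim: (enum _) => //= i s ->; rewrite rmorphB.
Qed.

Fact sigmaX_is_monoid_morphism a : monoid_morphism (sigmaX a).
Proof.
rewrite /sigmaX; split=> [|x y]; elim: (enum _) => //= i s ->;
  by rewrite (rmorph1, rmorphM).
Qed.

Fact sigmaX_is_scalable a : scalable (sigmaX a).
Proof.
by move=> u x; rewrite /sigmaX; elim: (enum _) => //= i s ->; rewrite linearZ.
Qed.

HB.instance Definition _ a := GRing.isZmodMorphism.Build R R (sigmaX a)
  (sigmaX_is_zmod_morphism a).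
HB.instance Definition _ a := GRing.isMonoidMorphism.Build R R (sigmaX a)
  (sigmaX_is_monoid_morphism a).
HB.instance Definition _ a := GRing.isScalable.Build k R R *:%R (sigmaX a)
  (sigmaX_is_scalable a).

Fact sigmaX0 r : sigmaX 0 r = r.
Proof. by rewrite /sigmaX; elim: (enum _) => //= i s ->; rewrite ffunE. Qed.

Fact sigmaXD a b r : sigmaX (a + b) r = sigmaX a (sigmaX b r).
Proof.
rewrite /sigmaX; elim: (enum _) => //= i s ->; rewrite ffunE sigmazD.
congr (sigmaz i _ _); move: (foldr _ r s) => x.
by elim: s => //= j s IH; rewrite sigmazC IH.
Qed.

Fact skew_coef0l a : skew_coef 0 a = 1.
Proof.
by rewrite /skew_coef; apply: big1 => j _; apply: big1 => i _; rewrite ffunE mul0r.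
Qed.

Fact skew_coef0r a : skew_coef a 0 = 1.
Proof.
by rewrite /skew_coef; apply: big1 => j _; apply: big1 => i _; rewrite ffunE mulr0.
Qed.

Fact skew_coefDl a b c : skew_coef (a + b) c = skew_coef a c * skew_coef b c.
Proof.
rewrite /skew_coef -big_split; apply: eq_bigr => j _ /=.
rewrite -big_split; apply: eq_bigr => i _ /=.
by rewrite ffunE mulrDl expfzDr ?sd_p_neq0.
Qed.

Fact skew_coefDr a b c : skew_coef a (b + c) = skew_coef a b * skew_coef a c.
Proof.
rewrite /skew_coef -big_split; apply: eq_bigr => j _ /=.
rewrite -big_split; apply: eq_bigr => i _ /=.
by rewrite ffunE mulrDr expfzDr ?sd_p_neq0.
Qed.

(* R_p[t^(+-1); sigma], realized on the free left R-module with basis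
   (t^a) = (t_1^(a_1) ... t_n^(a_n)); the monomial r t^a is << r *g a >>. *)
Definition skewLaurent (_ : skewDatum) := {malg R[multideg n]}.
Local Notation S := (skewLaurent D).
HB.instance Definition _ := GRing.Zmodule.on S.
Implicit Types f g h : S.

Local Notation term f g a b :=
  << skew_coef a b *: (f@_a * sigmaX a g@_b) *g a + b >>.

Definition skew_mul f g : S :=
  \sum_(a <- msupp f) \sum_(b <- msupp g) term f g a b.

Definition skew_one : S := << 1 *g (0 : multideg n) >>.

Fact skew_mulw (d1 d2 : {fset multideg n}) f g :
  (msupp f `<=` d1)%fset -> (msupp g `<=` d2)%fset ->
  skew_mul f g = \sum_(a <- d1) \sum_(b <- d2) term f g a b.
Proof.
move=> le_d1 le_d2; rewrite /skew_mul (big_fset_incl _ le_d1) /=.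
  apply: eq_bigr => a _; apply: big_fset_incl => // b _ /mcoeff_outdom ->.
  by rewrite rmorph0 mulr0 scaler0 monalgU0.
move=> a _ /mcoeff_outdom fa.
by rewrite big1 // => b _; rewrite fa mul0r scaler0 monalgU0.
Qed.

Fact skew_mul0 : left_zero 0 skew_mul.
Proof. by move=> g; rewrite /skew_mul msupp0 big_seq_fset0. Qed.

Fact skew_mulr0 : right_zero 0 skew_mul.
Proof.
by move=> g; rewrite /skew_mul big1 // => a _; rewrite msupp0 big_seq_fset0.
Qed.

Fact skew_mulDl : left_distributive skew_mul +%R.
Proof.
move=> f g h.
rewrite (skew_mulw (fsubsetUl (msupp f) (msupp g)) (fsubset_refl (msupp h))).
rewrite (skew_mulw (fsubsetUr (msupp f) (msupp g)) (fsubset_refl (msupp h))).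
rewrite (skew_mulw (msuppD_le _ _) (fsubset_refl _)).
rewrite -big_split /=; apply: eq_bigr => a _.
rewrite -big_split /=; apply: eq_bigr => b _.
by rewrite mcoeffD mulrDl scalerDr monalgUD.
Qed.

Fact skew_mulDr : right_distributive skew_mul +%R.
Proof.
move=> h f g.
rewrite (skew_mulw (fsubset_refl (msupp h)) (fsubsetUl (msupp f) (msupp g))).
rewrite (skew_mulw (fsubset_refl (msupp h)) (fsubsetUr (msupp f) (msupp g))).
rewrite (skew_mulw (fsubset_refl _) (msuppD_le _ _)).
rewrite -big_split /=; apply: eq_bigr => a _.
rewrite -big_split /=; apply: eq_bigr => b _.
by rewrite mcoeffD rmorphD mulrDr scalerDr monalgUD.
Qed.

Fact skew_mulUU (r s : R) a b : skew_mul << r *g a >> << s *g b >> =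
  << skew_coef a b *: (r * sigmaX a s) *g a + b >>.
Proof.
by rewrite (skew_mulw msuppU_le msuppU_le) !big_seq_fset1 !mcoeffUU.
Qed.

Fact skew_mul1g : left_id skew_one skew_mul.
Proof.
move=> g; rewrite (skew_mulw msuppU_le (fsubset_refl _)) big_seq_fset1.
rewrite [RHS]monalgE; apply: eq_bigr => a _.
by rewrite mcoeffUU skew_coef0l scale1r mul1r sigmaX0 add0r.
Qed.

Fact skew_mulg1 : right_id skew_one skew_mul.
Proof.
move=> g; rewrite (skew_mulw (fsubset_refl _) msuppU_le).
rewrite [RHS]monalgE; apply: eq_bigr => a _.
by rewrite big_seq_fset1 mcoeffUU skew_coef0r scale1r rmorph1 mulr1 addr0.
Qed.

Fact skew_mulA : associative skew_mul.
Proof.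
move=> f g h.
have suml I s (F : I -> _) x :
    skew_mul (\sum_(i <- s) F i) x = \sum_(i <- s) skew_mul (F i) x.
  exact: (big_morph (skew_mul^~ x) (fun _ _ => skew_mulDl _ _ _) (skew_mul0 _)).
have sumr I s (F : I -> _) x :
    skew_mul x (\sum_(i <- s) F i) = \sum_(i <- s) skew_mul x (F i).
  exact: (big_morph (skew_mul x) (fun _ _ => skew_mulDr _ _ _) (skew_mulr0 _)).
move: suml sumr skew_mulUU; move: skew_mul => mul suml sumr mulUU.
rewrite [f]monalgE !suml; apply: eq_bigr => a _.
rewrite [g]monalgE suml !sumr suml; apply: eq_bigr => b _.
rewrite [h]monalgE !sumr; apply: eq_bigr => c _.
rewrite !mulUU addrA; congr << _ *g _ >>.
rewrite linearZ rmorphM /= -sigmaXD -scalerAr -scalerAl !scalerA mulrA.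
by rewrite skew_coefDl skew_coefDr -[in LHS]mulrA [in LHS]mulrC.
Qed.

Fact skew_one_neq0 : skew_one != 0.
Proof. by rewrite monalgU_eq0 oner_eq0. Qed.

HB.instance Definition _ := GRing.Zmodule_isNzRing.Build S
  skew_mulA skew_mul1g skew_mulg1 skew_mulDl skew_mulDr skew_one_neq0.

Definition skew_const (r : R) : S := << r *g (0 : multideg n) >>.

Definition skew_t i z : S :=
  << 1 *g ([ffun j => if j == i then z else 0] : multideg n) >>.

Lemma skew_mulE (r s : R) a b :
  (<< r *g a >> : S) * << s *g b >> =
  << skew_coef a b *: (r * sigmaX a s) *g a + b >>.
Proof. exact: skew_mulUU. Qed.

Fact skew_const_is_zmod_morphism : zmod_morphism skew_const.
Proof. by move=> x y; rewrite /skew_const monalgUB. Qed.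

Fact skew_const_is_monoid_morphism : monoid_morphism skew_const.
Proof.
split=> // x y.
by rewrite /skew_const skew_mulE skew_coef0l scale1r sigmaX0 addr0.
Qed.

HB.instance Definition _ := GRing.isZmodMorphism.Build R S skew_const
  skew_const_is_zmod_morphism.
HB.instance Definition _ := GRing.isMonoidMorphism.Build R S
  skew_const skew_const_is_monoid_morphism.

(* The defining relations of R_p[t^(+-1); sigma], checked on the model. *)

Fact sigmaX_single i z r :
  sigmaX [ffun j => if j == i then z else 0] r = sigmaz i z r.
Proof.
rewrite /sigmaX; have : i \in enum 'I_n by rewrite mem_enum.
elim: (enum _) (enum_uniq 'I_n) => //= j s IH /andP[js us].
rewrite inE ffunE eq_sym; case: eqP => [ij|_] /=; last by move=> /(IH us).
move=> _; congr (sigmaz _ _ _); elim: s js {IH us} => //= l s IH.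
rewrite inE ffunE negb_or => /andP[jl /IH ->].
by rewrite eq_sym -ij (negPf jl).
Qed.

Lemma skew_t_const i z r :
  skew_t i z * skew_const r = skew_const (sigmaz i z r) * skew_t i z.
Proof.
rewrite !skew_mulE sigmaX_single skew_coef0l skew_coef0r addr0 add0r.
by rewrite mul1r sigmaX0 mulr1.
Qed.

Fact skew_coef_single i j z w :
  skew_coef [ffun l => if l == j then z else 0] [ffun l => if l == i then w else 0]
  = if (i < j)%N then p i j ^ (z * w) else 1.
Proof.
rewrite /skew_coef (bigD1 j) //= [X in _ * X]big1 => [|l /negPf lj]; last first.
  by apply: big1 => m _; rewrite ffunE lj mul0r.
rewrite mulr1; case: ifP => ij; last first.
  apply: big1 => m mj; rewrite !ffunE eqxx; case: eqP => [mi|]; last by rewrite mulr0.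
  by rewrite mi ij in mj.
rewrite (bigD1 i) //= big1 => [|m /andP[_ /negPf mi]]; rewrite !ffunE ?eqxx ?mulr1 //.
by rewrite mi mulr0.
Qed.

Lemma skew_tD i z w : skew_t i z * skew_t i w = skew_t i (z + w).
Proof.
rewrite skew_mulE skew_coef_single ltnn scale1r rmorph1 mulr1.
congr << _ *g _ >>; apply/ffunP => j; rewrite !ffunE.
by case: eqP => _; rewrite ?addr0.
Qed.

Lemma skew_t0 i : skew_t i 0 = 1.
Proof.
by congr << _ *g _ >>; apply/ffunP => j; rewrite !ffunE if_same.
Qed.

Lemma skew_tt i j : i != j ->
  skew_t j 1 * skew_t i 1 = skew_const ((p i j)%:A) * (skew_t i 1 * skew_t j 1).
Proof.
move=> ij; rewrite !skew_mulE !skew_coef_single !rmorph1 !mulr1 add0r addrC.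
congr << _ *g _ >>; rewrite skew_coef0l scale1r sigmaX0.
case: ltngtP (ij) => [lt_ij|lt_ji|eq_ij]; last by rewrite (val_inj eq_ij) eqxx.
  by move=> _; rewrite scale1r mulr1.
by move=> _; rewrite -scalerAl mul1r scalerA sd_p_antisym mulVf ?scale1r ?sd_p_neq0.
Qed.

Lemma skew_monomial r a :
  << r *g a >> = skew_const r * \prod_(i < n) skew_t i (a i) :> S.
Proof.
have tP (s : seq 'I_n) : sorted ltn (map val s) ->
    \prod_(i <- s) skew_t i (a i) =
    << 1 *g ([ffun j => if j \in s then a j else 0] : multideg n) >>.
  elim: s => [_|i s IH]; first by rewrite big_nil; congr << _ *g _ >>;
    apply/ffunP => j; rewrite !ffunE.
  rewrite /= big_cons (path_sortedE ltn_trans) => /andP[/allP is_lt /IH ->].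
  rewrite skew_mulE rmorph1 mulr1.
  have -> : skew_coef [ffun j => if j == i then a i else 0]
      [ffun j => if j \in s then a j else 0] = 1.
    rewrite /skew_coef; apply: big1 => j _; apply: big1 => l lj; rewrite !ffunE.
    case: eqP lj => [->|_]; last by rewrite mul0r.
    case: ifP => [ls|]; last by rewrite mulr0.
    by have := is_lt _ (map_f val ls); rewrite /= => /ltnW; rewrite leqNgt => /negPf->.
  rewrite scale1r; congr << _ *g _ >>; apply/ffunP => j; rewrite !ffunE inE.
  case: eqP => [->|_] /=; last by rewrite add0r.
  case: ifP => [js|]; last by rewrite addr0.
  by have := is_lt _ (map_f val js); rewrite /= ltnn.
have -> : \prod_(i < n) skew_t i (a i) = \prod_(i <- enum 'I_n) skew_t i (a i).
  by rewrite [index_enum _]unlock enumT.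
rewrite tP ?val_enum_ord ?iota_ltn_sorted //.
rewrite skew_mulE skew_coef0l scale1r sigmaX0 mulr1 add0r.
by congr << _ *g _ >>; apply/ffunP => j; rewrite ffunE mem_enum.
Qed.

End SkewLaurent.

Section BRAlgebra.
Variables (k : fieldType) (R : comAlgType k) (n : nat).

Definition br_ideal (D : skewDatum R n) (H J : 'I_n -> set R) i (z : int) : set R :=
  match z with
  | Posz m => \big[@ideal_mul R/setT]_(0 <= j < m) (sigmaz D i j%:Z @` J i)
  | Negz m => \big[@ideal_mul R/setT]_(0 <= j < m.+1)
                (sigmaz D i (- (j.+1)%:Z) @` H i)
  end.

(* As R is commutative, the requirements H_i H_k = H_k H_i, H_i J_k = J_k H_i
   and J_i J_k = J_k J_i hold automatically. *)
Record brDatum := BRDatum {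
  br_skew :> skewDatum R n;
  br_H : 'I_n -> set R;
  br_J : 'I_n -> set R;
  br_idealH : forall i, ideal (br_H i);
  br_idealJ : forall i, ideal (br_J i);
  br_sigmaH : forall i j, i != j -> sd_sigma br_skew i @` br_H j = br_H j;
  br_sigmaJ : forall i j, i != j -> sd_sigma br_skew i @` br_J j = br_J j;
  br_ideal_neq0 : forall i z,
    exists2 r, br_ideal br_skew br_H br_J i z r & r != 0 }.

Variable D : brDatum.
Local Notation sigma := (sd_sigma D).
Local Notation S := (skewLaurent D).
Implicit Types (i j : 'I_n) (z w : int) (a b : multideg n).

Definition br_I i z := br_ideal D (br_H D) (br_J D) i z.

Definition br_coeffs a : set R :=
  \big[@ideal_mul R/setT]_(i < n) br_I i (a i).

Definition br_pred : {pred S} := [pred f : S | `[< forall a, br_coeffs a f@_a >]].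

Fact ideal_image (f : {rmorphism R -> R}) g (I : set R) :
  cancel g f -> ideal I -> ideal (f @` I).
Proof.
move=> gK [I0 ID IM]; split; first by exists 0; rewrite ?rmorph0.
  by move=> _ _ [x Ix <-] [y Iy <-]; exists (x + y); rewrite ?rmorphD //; apply: ID.
by move=> u _ [x Ix <-]; exists (g u * x); rewrite ?rmorphM ?gK //; apply: IM.
Qed.

Fact sigmazK i z : cancel (sigmaz D i (- z)) (sigmaz D i z).
Proof. by move=> r; rewrite -sigmazD subrr. Qed.

Definition br_factorsJ i z m : seq (set R) :=
  [seq sigmaz D i (z + l%:Z) @` br_J D i | l <- iota 0 m].
Definition br_factorsH i z m : seq (set R) :=
  [seq sigmaz D i (z - (l.+1)%:Z) @` br_H D i | l <- iota 0 m].

Fact br_I_pos i m : br_I i m%:Z = ideal_prod (br_factorsJ i 0 m).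
Proof.
rewrite /br_I /br_ideal /ideal_prod big_map /index_iota subn0.
by apply: eq_bigr => j _; rewrite add0r.
Qed.

Fact br_I_neg i m : br_I i (- m%:Z) = ideal_prod (br_factorsH i 0 m).
Proof.
case: m => [|m].
  have -> : - 0%:Z = Posz 0 by [].
  by rewrite /br_I /br_ideal /ideal_prod !big_nil.
rewrite -NegzE /br_I /br_ideal /ideal_prod big_map /index_iota subn0.
by apply: eq_bigr => j _; rewrite add0r.
Qed.

Fact br_factorsJ_ideal i z m A : A \in br_factorsJ i z m -> ideal A.
Proof.
by case/mapP=> j _ ->; apply: (ideal_image (@sigmazK _ _)); apply: br_idealJ.
Qed.

Fact br_factorsH_ideal i z m A : A \in br_factorsH i z m -> ideal A.
Proof.
by case/mapP=> j _ ->; apply: (ideal_image (@sigmazK _ _)); apply: br_idealH.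
Qed.

Fact sigmaz_imageD i z w (A : set R) :
  sigmaz D i z @` (sigmaz D i w @` A) = sigmaz D i (z + w) @` A.
Proof. by rewrite image_comp; apply: eq_imagel => r _ /=; rewrite sigmazD. Qed.

Fact br_factorsJ_image i z w m :
  [seq sigmaz D i z @` (A : set R) | A <- br_factorsJ i w m] =
  br_factorsJ i (z + w) m.
Proof.
by rewrite -map_comp; apply: eq_map => j /=; rewrite sigmaz_imageD addrA.
Qed.

Fact br_factorsH_image i z w m :
  [seq sigmaz D i z @` (A : set R) | A <- br_factorsH i w m] =
  br_factorsH i (z + w) m.
Proof.
by rewrite -map_comp; apply: eq_map => j /=; rewrite sigmaz_imageD addrA.
Qed.

Fact br_factorsJ_cat i z m l :
  br_factorsJ i z (m + l) = br_factorsJ i z m ++ br_factorsJ i (z + m%:Z) l.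
Proof.
rewrite /br_factorsJ iotaD map_cat add0n -[X in iota X l]addn0 iotaDl -map_comp.
by congr (_ ++ _); apply: eq_map => j /=; rewrite PoszD addrA.
Qed.

Fact br_factorsH_cat i z m l :
  br_factorsH i z (m + l) = br_factorsH i z m ++ br_factorsH i (z - m%:Z) l.
Proof.
rewrite /br_factorsH iotaD map_cat add0n -[X in iota X l]addn0 iotaDl -map_comp.
by congr (_ ++ _); apply: eq_map => j /=; rewrite -addnS PoszD opprD addrA.
Qed.

Fact br_I_ideal i z : ideal (br_I i z).
Proof.
have [m [->|->]] : exists m : nat, z = m%:Z \/ z = - m%:Z.
- by case: z => m; [exists m; left | exists m.+1; right].
- by rewrite br_I_pos; apply/ideal_prod_ideal/br_factorsJ_ideal.
- by rewrite br_I_neg; apply/ideal_prod_ideal/br_factorsH_ideal.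
Qed.

Fact br_I_mul i z w x y : br_I i z x -> br_I i w y ->
  br_I i (z + w) (x * sigmaz D i z y).
Proof.
have JP u m := ideal_prod_ideal (@br_factorsJ_ideal i u m).
have HP u m := ideal_prod_ideal (@br_factorsH_ideal i u m).
have JI m t : ideal_prod (br_factorsJ i 0 m) t ->
    forall u, ideal_prod (br_factorsJ i u m) (sigmaz D i u t).
  move=> mt u; rewrite -[u in br_factorsJ _ u _]addr0 -br_factorsJ_image.
  exact: ideal_prod_image.
have HI m t : ideal_prod (br_factorsH i 0 m) t ->
    forall u, ideal_prod (br_factorsH i u m) (sigmaz D i u t).
  move=> mt u; rewrite -[u in br_factorsH _ u _]addr0 -br_factorsH_image.
  exact: ideal_prod_image.
have [m zE] : exists m : nat, z = m%:Z \/ z = - m%:Z.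
  by case: (z) => m; [exists m; left | exists m.+1; right].
have [l wE] : exists l : nat, w = l%:Z \/ w = - l%:Z.
  by case: (w) => l; [exists l; left | exists l.+1; right].
case: zE wE => -> [] -> zx wy; rewrite ?(br_I_pos, br_I_neg) in zx wy;
  [move: wy => /JI zy|move: wy => /HI zy|move: wy => /JI zy|move: wy => /HI zy].
- rewrite -PoszD br_I_pos br_factorsJ_cat add0r.
  by apply: ideal_prod_cat zx (zy _) => A /br_factorsJ_ideal.
- have [lm|ml] := leqP l m.
    rewrite subzn // br_I_pos; move: zx; rewrite -{1}(subnK lm) br_factorsJ_cat.
    move=> /(ideal_prod_catl (@br_factorsJ_ideal _ _ _)) zx.
    by have [_ _ M] := JP 0 (m - l)%N; rewrite mulrC; apply: M.
  have -> : m%:Z - l%:Z = - (l - m)%N%:Z by rewrite -subzn 1?ltnW // opprB.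
  rewrite br_I_neg; move: (zy m%:Z); rewrite -{1}(subnKC (ltnW ml)).
  rewrite br_factorsH_cat subrr.
  move=> /(ideal_prod_catr (@br_factorsH_ideal _ _ _)).
  by have [_ _ M] := HP 0 (l - m)%N; apply: M.
- have [lm|ml] := leqP l m.
    have -> : - m%:Z + l%:Z = - (m - l)%N%:Z by rewrite -subzn // opprB addrC.
    rewrite br_I_neg; move: zx; rewrite -{1}(subnK lm) br_factorsH_cat.
    move=> /(ideal_prod_catl (@br_factorsH_ideal _ _ _)) zx.
    by have [_ _ M] := HP 0 (m - l)%N; rewrite mulrC; apply: M.
  rewrite addrC subzn 1?ltnW // br_I_pos; move: (zy (- m%:Z)).
  rewrite -{1}(subnKC (ltnW ml)) br_factorsJ_cat addNr.
  move=> /(ideal_prod_catr (@br_factorsJ_ideal _ _ _)).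
  by have [_ _ M] := JP 0 (l - m)%N; apply: M.
- rewrite -opprD -PoszD br_I_neg br_factorsH_cat add0r.
  by apply: ideal_prod_cat zx (zy _) => A /br_factorsH_ideal.
Qed.

Fact sigmaz_image_fix i (A : set R) z :
  sigma i @` A = A -> sigmaz D i z @` A = A.
Proof.
move=> fixA; have pos m : sigmaz D i m%:Z @` A = A.
  elim: m => [|m IH]; first exact: image_id.
  by rewrite -addn1 PoszD -sigmaz_imageD [sigmaz D i 1 @` A]fixA.
have [m [->|->]] : exists m : nat, z = m%:Z \/ z = - m%:Z.
- by case: z => m; [exists m; left | exists m.+1; right].
- exact: pos.
- by rewrite -{1}(pos m) sigmaz_imageD addNr; apply: image_id.
Qed.

Fact sigmaz_imageC i j z w (A : set R) :
  sigmaz D i z @` (sigmaz D j w @` A) = sigmaz D j w @` (sigmaz D i z @` A).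
Proof. by rewrite !image_comp; apply: eq_imagel => r _ /=; rewrite sigmazC. Qed.

Fact br_I_sigmaz i j z w x : i != j -> br_I i w x -> br_I i w (sigmaz D j z x).
Proof.
move=> ij; have ji : j != i by rewrite eq_sym.
have [m [->|->]] : exists m : nat, w = m%:Z \/ w = - m%:Z.
- by case: w => m; [exists m; left | exists m.+1; right].
- rewrite br_I_pos => /(ideal_prod_image (sigmaz D j z)).
  rewrite -map_comp [X in ideal_prod X _](_ : _ = br_factorsJ i 0 m) //.
  apply: eq_map => l /=.
  by rewrite sigmaz_imageC (sigmaz_image_fix _ (br_sigmaJ D ji)).
- rewrite br_I_neg => /(ideal_prod_image (sigmaz D j z)).
  rewrite -map_comp [X in ideal_prod X _](_ : _ = br_factorsH i 0 m) //.
  apply: eq_map => l /=.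
  by rewrite sigmaz_imageC (sigmaz_image_fix _ (br_sigmaH D ji)).
Qed.

Fact br_I_mulX i a b x y : br_I i (a i) x -> br_I i (b i) y ->
  br_I i ((a + b) i) (x * sigmaX D a y).
Proof.
move=> xa yb; rewrite ffunE.
pose a' : multideg n := [ffun j => if j == i then 0 else a j].
have -> : sigmaX D a y = sigmaz D i (a i) (sigmaX D a' y).
  rewrite -(sigmaX_single D i (a i)) -sigmaXD; congr (sigmaX D _ y).
  by apply/ffunP=> j; rewrite !ffunE; case: eqP => [->|]; rewrite ?addr0 ?add0r.
apply: br_I_mul => //.
rewrite /sigmaX; elim: (enum _) => //= j s IH; rewrite ffunE.
by case: eqP => [_ //|/eqP ji]; apply: br_I_sigmaz; rewrite // eq_sym.
Qed.

Fact br_coeffsE a : br_coeffs a = ideal_prod [seq br_I i (a i) | i <- enum 'I_n].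
Proof. by rewrite /ideal_prod big_map enumT /br_coeffs [index_enum _]unlock. Qed.

Fact br_coeffs_ideal a : ideal (br_coeffs a).
Proof.
by rewrite br_coeffsE; apply: ideal_prod_ideal => _ /mapP[i _ ->]; apply: br_I_ideal.
Qed.

Fact ideal_prod_mul (A B E : 'I_n -> set R) (s : seq 'I_n) x y :
    (forall i, ideal (E i)) -> (forall i u v, A i u -> B i v -> E i (u * v)) ->
    ideal_prod [seq A i | i <- s] x -> ideal_prod [seq B i | i <- s] y ->
  ideal_prod [seq E i | i <- s] (x * y).
Proof.
move=> Eideal ABE; elim: s x y => [|i s IH] x y.
  by rewrite /ideal_prod !big_nil.
have [K0 KD KM] : ideal (ideal_prod [seq E i | i <- i :: s]).
  by apply: ideal_prod_ideal => _ /mapP[j _ ->].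
move=> + yB; move: x; rewrite {1}/ideal_prod /= big_cons.
apply: ideal_mul_min => [|x x'|u v Au Av]; rewrite ?mul0r ?mulrDl //; first exact: KD.
move: y yB; rewrite {1}/ideal_prod /= big_cons.
apply: ideal_mul_min => [|y y'|u' v' Bu Bv]; rewrite ?mulr0 ?mulrDr //; first exact: KD.
rewrite mulrACA /ideal_prod big_cons; apply: ideal_mulP; first exact: ABE.
exact: IH.
Qed.

Fact br_coeffs_mul a b x y :
  br_coeffs a x -> br_coeffs b y -> br_coeffs (a + b) (x * sigmaX D a y).
Proof.
rewrite !br_coeffsE => xa /(ideal_prod_image (sigmaX D a)); rewrite -map_comp.
apply: ideal_prod_mul xa => i; first exact: br_I_ideal.
by move=> u _ au [v bv <-]; apply: br_I_mulX.
Qed.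

Fact br_coeffs01 r : br_coeffs 0 r.
Proof.
have [_ _ M] := br_coeffs_ideal 0; rewrite -[r]mulr1; apply: M.
rewrite br_coeffsE; elim: (enum _) => [|i s IH]; rewrite /ideal_prod ?big_nil //=.
rewrite big_cons -[1]mulr1; apply: ideal_mulP => //.
have -> : (0 : multideg n) i = Posz 0 by rewrite ffunE.
by rewrite /br_I /br_ideal big_nil.
Qed.

Fact br_coeffs_sum (I : eqType) (s : seq I) (F : I -> R) a :
  (forall x, x \in s -> br_coeffs a (F x)) -> br_coeffs a (\sum_(x <- s) F x).
Proof.
have [K0 KD _] := br_coeffs_ideal a.
by move=> FP; rewrite big_seq; elim/big_ind: _.
Qed.

Fact br_predP (f : S) : reflect (forall a, br_coeffs a f@_a) (f \in br_pred).
Proof. by rewrite inE; apply: asboolP. Qed.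

Fact br_pred_const r : skew_const D r \in br_pred.
Proof.
apply/br_predP => a; rewrite mcoeffU; case: eqP => [<-|_].
  by rewrite mulr1n; apply: br_coeffs01.
by rewrite mulr0n; case: (br_coeffs_ideal a).
Qed.

Fact br_subring_closed : subring_closed br_pred.
Proof.
split=> [|f g /br_predP Bf /br_predP Bg|f g /br_predP Bf /br_predP Bg].
- exact: (br_pred_const 1).
- apply/br_predP => a; rewrite mcoeffB; have [_ KD KM] := br_coeffs_ideal a.
  by apply: KD => //; rewrite -mulN1r; apply: KM.
apply/br_predP => c; have [K0 _ KM] := br_coeffs_ideal c.
rewrite [f * g]/(skew_mul f g) raddf_sum /=; apply: br_coeffs_sum => a _.
rewrite raddf_sum /=; apply: br_coeffs_sum => b _.
rewrite mcoeffU; case: eqP => [<-|_]; last by rewrite mulr0n.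
rewrite mulr1n -mulr_algl.
by have [_ _ M] := br_coeffs_ideal (a + b); apply/M/br_coeffs_mul.
Qed.

HB.instance Definition _ := GRing.isSubringClosed.Build S br_pred
  br_subring_closed.

(* B = R_p(t, sigma, H, J), the sum of the B_a = I_1^(a_1) ... I_n^(a_n) t^a. *)
Definition brAlgebra := {f : S | f \in br_pred}.
HB.instance Definition _ := SubType.on brAlgebra.
HB.instance Definition _ := Choice.on brAlgebra.
HB.instance Definition _ := [SubChoice_isSubNzRing of brAlgebra by <:].

Definition br_const (r : R) : brAlgebra := exist _ (skew_const D r) (br_pred_const r).

End BRAlgebra.

Section Modules.
Variable B : nzRingType.

Definition simple_module (M : lmodType B) :=
  (exists v : M, v != 0) /\
  (forall N : {pred M}, GRing.submod_closed N ->
     (forall v, v \in N -> v = 0) \/ (forall v, v \in N)).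

Definition isomorphic (M N : lmodType B) := exists f : {linear M -> N}, bijective f.

End Modules.

Definition is_direct_sum (T : choiceType) (M : zmodType) (P : set T)
    (V : T -> set M) :=
  (forall v : M, exists s : seq T, exists w : T -> M,
     [/\ uniq s, forall x, x \in s -> P x /\ V x (w x) & v = \sum_(x <- s) w x]) /\
  (forall (s : seq T) (w : T -> M), uniq s ->
     (forall x, x \in s -> P x /\ V x (w x)) -> \sum_(x <- s) w x = 0 ->
     forall x, x \in s -> w x = 0).

Inductive extended (T : Type) := MinusInfty | Class of T | PlusInfty.
Arguments MinusInfty {T}.
Arguments Class {T} _.
Arguments PlusInfty {T}.
HB.instance Definition _ (T : Type) := gen_eqMixin (extended T).
HB.instance Definition _ (T : Type) := gen_choiceMixin (extended T).

Section WeightModules.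
Variables (k : fieldType) (R : comAlgType k) (n : nat) (D : brDatum R n).
Implicit Types (M : lmodType (brAlgebra D)) (m : set R) (i : 'I_n).

Definition weight_space M m : set M :=
  [set v | forall r, m r -> br_const D r *: v = 0].

Definition supp M : set (set R) :=
  [set m | maximal_ideal m /\ exists2 v : M, weight_space m v & v != 0].

Definition weight_module M :=
  is_direct_sum (@maximal_ideal R) (@weight_space M).

Definition in_wmod (O : set (set R)) M := weight_module M /\ supp M `<=` O.

Definition is_orbit (O : set (set R)) :=
  exists2 m, maximal_ideal m & O = [set sigmaX D a @` m | a in setT].

Definition torsion_free (O : set (set R)) :=
  forall m (a : multideg n), O m -> sigmaX D a @` m = m -> a = 0.

Definition prec i : set R -> set R -> Prop :=
  clos_trans (set R) (fun m m' => m' = sd_sigma D i @` m).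

Definition preceq i m m' := m = m' \/ prec i m m'.

(* The subgroup generated by the sigma_k with k != i consists of the sigma^a
   with a_i = 0. *)
Definition Gamma_orbit i m : set (set R) :=
  [set sigmaX D a @` m | a in [set a : multideg n | a i = 0]].

Definition breaks (O : set (set R)) i : set (set R) :=
  [set m | O m /\ ideal_mul (br_H D i) (br_J D i) `<=` sd_sigma D i @` m].

Definition break_classes O i : set (set (set R)) := Gamma_orbit i @` breaks O i.

Definition class_prec i (c d : set (set R)) :=
  exists m m', [/\ c m, d m' & prec i m m'].

Definition has_maximal_class O i :=
  exists2 c, break_classes O i c &
    forall d, break_classes O i d -> ~ class_prec i c d.

Definition ext_break_classes O i : set (extended (set (set R))) :=
  [set e | match e with
           | MinusInfty => False
           | Class c => break_classes O i c
           | PlusInfty => break_classes O i = set0 \/ has_maximal_class O i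
           end].

Definition ext_prec i (e e' : extended (set (set R))) :=
  match e, e' with
  | Class c, Class d => class_prec i c d
  | MinusInfty, Class _ | MinusInfty, PlusInfty | Class _, PlusInfty => True
  | _, _ => False
  end.

(* [n]^-; [xget] returns -infinity when there is no largest element below e,
   i.e. when e is minimal. *)
Definition ext_pred O i (e : extended (set (set R))) :=
  xget MinusInfty
    [set e' | [/\ ext_break_classes O i e', ext_prec i e' e
      & forall e'', ext_break_classes O i e'' -> ext_prec i e'' e ->
          e'' = e' \/ ext_prec i e'' e']].

Definition ext_prec_elt i (e : extended (set (set R))) m :=
  match e with
  | MinusInfty => True
  | Class c => exists2 m', c m' & prec i m' m
  | PlusInfty => False
  end.

Definition elt_preceq_ext i m (e : extended (set (set R))) :=
  match e with
  | MinusInfty => False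
  | Class c => exists2 m', c m' & preceq i m m'
  | PlusInfty => True
  end.

Definition box O (e : 'I_n -> extended (set (set R))) : set (set R) :=
  [set m | O m /\ forall i,
     ext_prec_elt i (ext_pred O i (e i)) m /\ elt_preceq_ext i m (e i)].

End WeightModules.

(* Main.v *)
From HB Require Import structures.
Require Import Defs.
From mathcomp Require Import all_boot all_order all_algebra zify.
From mathcomp Require Import finmap monalg generic_quotient ring_quotient.
From mathcomp Require Import boolp classical_sets.
Set Implicit Arguments.
Unset Strict Implicit.
Unset Printing Implicit Defensive.
Import Order.TTheory GRing.Theory Num.Theory.
Local Open Scope classical_set_scope.
Local Open Scope ring_scope.

(** Fix a maximal ideal m in the orbit O, and write x_a for the coefficient of
    x in degree a. The degree a part of B maps the weight space of m into that
    of sigma^a(m). Because O is torsion-free, these target weights are pairwise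
    distinct, so whenever x v is a weight vector, for v of weight m, it equals a
    single x_a t^a v [weight_component].

    This pins down a simple weight module M from any one of its weights m. If v
    is a nonzero vector of weight m, its annihilator is
    N_m = { x | (y x)_0 in m for all y } [simple_annihilator]: x v is nonzero
    iff some y brings it back to v, and then (y x)_0 v = v. The right-hand side
    does not mention M, hence two simple modules sharing a weight are isomorphic
    [simple_isomorphic]. Conversely B / N_m is a simple weight module with m in
    its support [orbit_exists_simple]. So simple modules up to isomorphism are
    the classes of a partition of O into supports.

    It remains to identify the partition. The point sigma^a(m) is in the support
    through m iff the ideal B_{-a} B_a of R is not contained in m [simple_supp].
    This ideal is a product of shifts of the H_i and J_i and m is prime, so the
    condition is checked factor by factor; as H_i and J_i are fixed by sigma_k
    for k <> i, each factor sees only the coordinate a_i, and the outcome is that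
    no i-break lies between m and sigma^a(m), for any i [linkedP]. Thus
    coordinate i of a support runs over the integers between two consecutive
    breaks, the upper one included; this interval is determined by the first
    break at or above any of its points, or by infinity if there is none
    [next_break]. These data are exactly the elements of the extended set of
    break classes, and the interval attached to e consists of the points above
    the predecessor of e and not above e [next_breakP]. *)

(** * Maximal ideals of a commutative ring *)

Section MaximalIdeals.
Variable R : comNzRingType.
Implicit Types m I J : set R.

Lemma idealN I x : ideal I -> I x -> I (- x).
Proof. by move=> [_ _ IM] Ix; rewrite -mulN1r; apply: IM. Qed.

Lemma ideal_sum I (T : Type) (s : seq T) (P : pred T) (F : T -> R) : ideal I ->
  (forall i, P i -> I (F i)) -> I (\sum_(i <- s | P i) F i).
Proof. by move=> [I0 ID _] FI; elim/big_ind: _. Qed.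

(** The ideal of all x with x - q r in m for some q contains m and r, so it is the
    whole ring. *)
Lemma maximal_bezout m r : maximal_ideal m -> ~ m r -> exists q, m (1 - q * r).
Proof.
move=> [[m0 mD mM] m1 mmax] mr.
pose J := [set x | exists q, m (x - q * r)].
have JP : ideal J.
  split=> [|x y [q mq] [q' mq']|a x [q mq]].
  - by exists 0; rewrite mul0r subr0.
  - by exists (q + q'); rewrite mulrDl opprD addrACA; apply: mD.
  - by exists (a * q); rewrite -mulrA -mulrBr; apply: mM.
have Jr : J r by exists 1; rewrite mul1r subrr.
have mJ : m `<=` J by move=> x mx; exists 0; rewrite mul0r subr0.
by apply: contrapT => J1; apply: mr; rewrite -(mmax J JP J1 mJ).
Qed.

Lemma maximal_prime m x y : maximal_ideal m -> m (x * y) -> m x \/ m y.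
Proof.
move=> mm mxy; have [mx|/(maximal_bezout mm)[q mq]] := pselect (m x).
  by left.
case: mm => [[m0 mD mM] _ _]; right.
have -> : y = y * (1 - q * x) + q * (x * y).
  by rewrite mulrBr mulr1 [y * _]mulrC -mulrA subrK.
by apply: mD; apply: mM.
Qed.

Lemma maximal_eq m m' : maximal_ideal m -> maximal_ideal m' -> m `<=` m' -> m = m'.
Proof. by move=> [_ _ mmax] [m'I m'1 _] /(mmax _ m'I m'1). Qed.

(** Distinct maximal ideals are incomparable, so for each i there is an element of
    mu i outside m; m being prime, the product of these works. Acting by such an
    r kills all weights mu i while remaining invertible on weight m. *)
Lemma maximal_avoid (T : eqType) (s : seq T) (mu : T -> set R) m :
  maximal_ideal m -> (forall i, i \in s -> maximal_ideal (mu i) /\ mu i <> m) ->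
  exists2 r, ~ m r & forall i, i \in s -> mu i r.
Proof.
move=> mm; elim: s => [|i s IHs] muP; first by exists 1 => //; case: mm.
have [|r mr rmu] := IHs; first by move=> j js; apply: muP; rewrite inE js orbT.
have [mui neq] := muP i (mem_head _ _).
have [q muq mq] : exists2 q, mu i q & ~ m q.
  apply: contrapT => nq; apply: neq; apply: maximal_eq => // q muq.
  by apply: contrapT => mq; apply: nq; exists q.
exists (q * r) => [/(maximal_prime mm)[]//|j].
rewrite inE => /predU1P[->|js].
  by rewrite mulrC; case: mui => [[_ _ mM] _ _]; apply: mM.
by have [[[_ _ mM] _ _] _] := muP j (mem_behead (s := i :: s) js); apply: mM;
  apply: rmu.
Qed.

Lemma ideal_mul_maximal m I J : maximal_ideal m ->
  ideal_mul I J `<=` m <-> (I `<=` m \/ J `<=` m).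
Proof.
move=> mm; case: (mm) => -[m0 mD mM] _ _; split=> [IJm|IJm].
  have [Im|nIm] := pselect (I `<=` m); [by left|right=> y Jy].
  apply: contrapT => my; apply: nIm => x Ix.
  by have /(maximal_prime mm)[] := IJm _ (ideal_mulP Ix Jy).
apply: ideal_mul_min => // x y Ix Jy.
by case: IJm => [/(_ x Ix) mx|/(_ y Jy)]; [rewrite mulrC|]; apply: mM.
Qed.

(** A maximal ideal is prime, so containments of products are decided on the
    factors. *)
Lemma ideal_prod_maximal m (s : seq (set R)) : maximal_ideal m ->
  ideal_prod s `<=` m <-> exists2 I, I \in s & I `<=` m.
Proof.
move=> mm; rewrite /ideal_prod; elim: s => [|I s IHs].
  rewrite big_nil; split=> [/(_ 1 Logic.I)|[]//].
  by case: mm.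
rewrite big_cons ideal_mul_maximal // IHs; split=> [[Im|[J Js Jm]]|[J]].
- by exists I; rewrite ?mem_head.
- by exists J; rewrite // inE Js orbT.
- by rewrite inE => /predU1P[->|Js] Jm; [left|right; exists J].
Qed.

End MaximalIdeals.

Lemma scale_ideal (k : fieldType) (R : comAlgType k) (I : set R) (c : k) r :
  ideal I -> I r -> I (c *: r).
Proof. by move=> [_ _ IM] Ir; rewrite -mulr_algl; apply: IM. Qed.

Lemma scale_idealE (k : fieldType) (R : comAlgType k) (I : set R) (c : k) r :
  ideal I -> c != 0 -> I (c *: r) -> I r.
Proof.
by move=> iI c0 /(scale_ideal c^-1 iI); rewrite scalerA mulVf ?scale1r.
Qed.

(** * Quotient of a module by a submodule *)

Section LmodQuotient.
Local Open Scope quotient_scope.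
Variables (B : pzRingType) (V : lmodType B) (N : {pred V}).
Hypothesis N_submod : GRing.submod_closed N.

(** The proof is an argument so that the additive subgroup structure, which the
    quotient construction infers, can be attached to the name. *)
Definition quot_kernel of GRing.submod_closed N : {pred V} := N.
Local Notation K := (quot_kernel N_submod).
HB.instance Definition _ := GRing.isZmodClosed.Build V K
  (GRing.submod_closedB N_submod).

Definition lmod_quot : Type := Quotient.quot K.
HB.instance Definition _ := GRing.Zmodule.on lmod_quot.

Definition lmod_pi (x : V) : lmod_quot := \pi_(Quotient.quot K) x.

Lemma lmod_pi_eq x y : lmod_pi x = lmod_pi y <-> x - y \in N.
Proof.
by rewrite -[N]/K Quotient.idealrBE; split=> [/eqP|/eqP].
Qed.

Lemma lmod_pi_surj q : exists x, q = lmod_pi x.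
Proof. by exists (repr (q : Quotient.quot K)); rewrite /lmod_pi reprK. Qed.

Lemma lmod_piD x y : lmod_pi (x + y) = lmod_pi x + lmod_pi y.
Proof. exact: (Quotient.pi_add K). Qed.

Definition lmod_quot_scale (b : B) (q : lmod_quot) : lmod_quot :=
  lmod_pi (b *: repr (q : Quotient.quot K)).

Lemma lmod_quot_scaleE b x : lmod_quot_scale b (lmod_pi x) = lmod_pi (b *: x).
Proof.
apply/lmod_pi_eq; rewrite -scalerBr.
have [N0 NZ] := N_submod; rewrite -[_ *: _]addr0; apply: NZ => //.
by apply/lmod_pi_eq; rewrite /lmod_pi reprK.
Qed.

Fact lmod_quot_scaleA a b q :
  lmod_quot_scale a (lmod_quot_scale b q) = lmod_quot_scale (a * b) q.
Proof. by have [x ->] := lmod_pi_surj q; rewrite !lmod_quot_scaleE scalerA. Qed.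

Fact lmod_quot_scale1 : left_id 1 lmod_quot_scale.
Proof. by move=> q; have [x ->] := lmod_pi_surj q;
  rewrite lmod_quot_scaleE scale1r. Qed.

Fact lmod_quot_scaleDr : right_distributive lmod_quot_scale +%R.
Proof.
move=> b p q; have [x ->] := lmod_pi_surj p; have [y ->] := lmod_pi_surj q.
by rewrite -lmod_piD !lmod_quot_scaleE scalerDr lmod_piD.
Qed.

Fact lmod_quot_scaleDl q : {morph lmod_quot_scale^~ q : a b / a + b}.
Proof.
move=> a b; have [x ->] := lmod_pi_surj q.
by rewrite !lmod_quot_scaleE scalerDl lmod_piD.
Qed.

HB.instance Definition _ := GRing.Zmodule_isLmodule.Build B lmod_quot
  lmod_quot_scaleA lmod_quot_scale1 lmod_quot_scaleDr lmod_quot_scaleDl.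

Lemma lmod_pi_is_linear : linear lmod_pi.
Proof. by move=> b x y; rewrite lmod_piD -lmod_quot_scaleE. Qed.

HB.instance Definition _ := GRing.isLinear.Build B V lmod_quot *:%R lmod_pi
  lmod_pi_is_linear.

(** Hides the representation of the quotient: only surjectivity and the kernel
    matter below. *)
Lemma submodule_quotient : exists (M : lmodType B) (p : {linear V -> M}),
  (forall q, exists x, q = p x) /\ (forall x y, p x = p y <-> x - y \in N).
Proof.
by exists lmod_quot, lmod_pi; split; [exact: lmod_pi_surj|exact: lmod_pi_eq].
Qed.

End LmodQuotient.
(** * The action on ideals and torsion-free orbits *)

Section Orbits.
Variables (k : fieldType) (R : comAlgType k) (n : nat) (D : skewDatum R n).
Implicit Types (m : set R) (a b : multideg n).

Lemma sigmaXNK a : cancel (sigmaX D a) (sigmaX D (- a)).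
Proof. by move=> r; rewrite -sigmaXD addNr sigmaX0. Qed.

Lemma sigmaXKN a : cancel (sigmaX D (- a)) (sigmaX D a).
Proof. by move=> r; rewrite -sigmaXD subrr sigmaX0. Qed.

Lemma sigmaX_imageE a m r : (sigmaX D a @` m) r <-> m (sigmaX D (- a) r).
Proof.
split=> [[s ms <-]|mr]; first by rewrite sigmaXNK.
by exists (sigmaX D (- a) r); rewrite ?sigmaXKN.
Qed.

Lemma sigmaX_image0 m : sigmaX D 0 @` m = m.
Proof. by apply/seteqP; split=> r; rewrite sigmaX_imageE oppr0 sigmaX0. Qed.

Lemma sigmaX_imageD a b m :
  sigmaX D a @` (sigmaX D b @` m) = sigmaX D (a + b) @` m.
Proof. by rewrite image_comp; apply: eq_imagel => r _ /=; rewrite sigmaXD. Qed.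

Lemma sigmaX_sub a (I J : set R) :
  sigmaX D a @` I `<=` sigmaX D a @` J <-> I `<=` J.
Proof.
split=> [IJ r Ir|IJ]; last exact: image_subset.
by rewrite -[r](sigmaXNK a); apply/sigmaX_imageE/IJ; exists r.
Qed.

Lemma sigmaX_maximal a m : maximal_ideal m -> maximal_ideal (sigmaX D a @` m).
Proof.
have idealX b (I : set R) : ideal I -> ideal (sigmaX D b @` I).
  exact: (ideal_image (@sigmaXKN b)).
move=> [mI m1 mmax]; split=> [||J JI J1 mJ]; first exact: idealX.
  by move/sigmaX_imageE; rewrite rmorph1.
rewrite -(mmax (sigmaX D (- a) @` J)) ?sigmaX_imageD ?subrr ?sigmaX_image0 //.
- exact: idealX.
- by move/sigmaX_imageE; rewrite rmorph1.
- by apply/(sigmaX_sub a); rewrite sigmaX_imageD subrr sigmaX_image0.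
Qed.

End Orbits.

Section TorsionFreeOrbit.
Variables (k : fieldType) (R : comAlgType k) (n : nat) (D : brDatum R n).
Variable O : set (set R).
Hypotheses (O_orbit : is_orbit D O) (O_free : torsion_free D O).
Implicit Types (m : set R) (a b : multideg n).

Lemma orbit_maximal m : O m -> maximal_ideal m.
Proof.
by have [m0 mm0 ->] := O_orbit; move=> [a _ <-]; apply: sigmaX_maximal.
Qed.

Lemma orbit_sigmaX m a : O m -> O (sigmaX D a @` m).
Proof.
have [m0 mm0 ->] := O_orbit; move=> [b _ <-].
by exists (a + b); rewrite ?sigmaX_imageD.
Qed.

Lemma orbit_trans m m' : O m -> O m' -> exists a, m' = sigmaX D a @` m.
Proof.
have [m0 mm0 ->] := O_orbit; move=> [a _ <-] [b _ <-].
by exists (b - a); rewrite sigmaX_imageD subrK.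
Qed.

Lemma orbit_inj m : O m -> injective (fun a => sigmaX D a @` m).
Proof.
move=> Om a b /= mab; apply/eqP; rewrite -subr_eq0; apply/eqP.
apply: (O_free Om); rewrite addrC -sigmaX_imageD mab sigmaX_imageD addNr.
exact: sigmaX_image0.
Qed.

End TorsionFreeOrbit.

(** * Homogeneous components in the BR algebra *)

Section Homogeneous.
Variables (k : fieldType) (R : comAlgType k) (n : nat) (D : brDatum R n).
Local Notation B := (brAlgebra D).
Local Notation S := (skewLaurent D).
Implicit Types (m : set R) (a b : multideg n) (x y : B).

Lemma br_monoP r a : br_coeffs D a r -> (<< r *g a >> : S) \in @br_pred k R n D.
Proof.
move=> ar; apply/br_predP => b; rewrite mcoeffU; case: eqP => [<-|_].
  by rewrite mulr1n.
by rewrite mulr0n; case: (br_coeffs_ideal D b).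
Qed.

Definition br_mono r a (ar : br_coeffs D a r) : B :=
  exist (fun f : S => f \in @br_pred k R n D) << r *g a >> (br_monoP ar).

Definition br_coef x a : R := (val x : S)@_a.

Lemma br_coefP x a : br_coeffs D a (br_coef x a).
Proof. by move/br_predP: (valP x). Qed.

Definition br_term x a : B := br_mono (br_coefP x a).

Lemma br_coefD x y a : br_coef (x + y) a = br_coef x a + br_coef y a.
Proof. exact: mcoeffD. Qed.

Lemma br_coefB x y a : br_coef (x - y) a = br_coef x a - br_coef y a.
Proof. exact: mcoeffB. Qed.

Lemma br_coef_const r a : br_coef (br_const D r) a = r *+ (a == 0).
Proof. by rewrite /br_coef /= mcoeffU eq_sym. Qed.

Lemma br_coef1 a : br_coef 1 a = (a == 0)%:R.
Proof. exact: br_coef_const. Qed.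

Lemma br_sum_terms x : x = \sum_(a <- msupp (val x : S)) br_term x a.
Proof.
apply: val_inj; rewrite [LHS](monalgE (val x : S)).
by rewrite raddf_sum.
Qed.

(** The degree 0 part of B is R itself, so degree 0 components act by scalars. *)
Lemma br_term0 x : br_term x 0 = br_const D (br_coef x 0).
Proof. exact: val_inj. Qed.

Lemma br_coefM x y b : br_coef (x * y) b =
  \sum_(a <- msupp (val x : S)) \sum_(c <- msupp (val y : S))
    (skew_coef D a c *: (br_coef x a * sigmaX D a (br_coef y c))) *+ (a + c == b).
Proof.
rewrite /br_coef [val (x * y)]/(skew_mul (val x : S) (val y)) /skew_mul.
rewrite raddf_sum /=; apply: eq_bigr => a _; rewrite raddf_sum /=.
by apply: eq_bigr => c _; rewrite mcoeffU.
Qed.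

Lemma br_coef_constM r x a : br_coef (br_const D r * x) a = r * br_coef x a.
Proof.
rewrite /br_coef [X in X@_a](_ : _ = skew_const D r * (val x : S)) //.
rewrite {1}[val x : S]monalgE mulr_sumr raddf_sum /= [in RHS](monalgE (val x : S)).
rewrite raddf_sum mulr_sumr /=; apply: eq_bigr => b _.
rewrite skew_mulE skew_coef0l scale1r sigmaX0 add0r !mcoeffU.
by case: eqP => _; rewrite ?mulr1n ?mulr0n ?mulr0.
Qed.

Lemma br_const_term x a s :
  br_const D (sigmaX D a s) * br_term x a = br_term x a * br_const D s.
Proof.
apply: val_inj; rewrite /= !skew_mulE skew_coef0l skew_coef0r sigmaX0 !scale1r.
by rewrite add0r addr0 mulrC.
Qed.

(** The product of opposite degrees, up to a nonzero scalar: these elements span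
    the ideal B_{-a} B_a of R. *)
Lemma br_monoM a u w (ua : br_coeffs D (- a) u) (wa : br_coeffs D a w) :
  br_mono ua * br_mono wa =
  br_const D (skew_coef D (- a) a *: (u * sigmaX D (- a) w)).
Proof. by apply: val_inj; rewrite /= skew_mulE addNr. Qed.

Lemma skew_coef_neq0 a b : skew_coef D a b != 0.
Proof.
by rewrite /skew_coef; apply/prodf_neq0 => i _; apply/prodf_neq0 => j _;
  rewrite expfz_neq0 ?sd_p_neq0.
Qed.

Lemma br_const_is_zmod_morphism : zmod_morphism (br_const D).
Proof. by move=> r s; apply: val_inj; rewrite /= rmorphB. Qed.

Lemma br_const_is_monoid_morphism : monoid_morphism (br_const D).
Proof. by split=> [|r s]; apply: val_inj; rewrite /= ?rmorphM. Qed.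

HB.instance Definition _ := GRing.isZmodMorphism.Build R B (br_const D)
  br_const_is_zmod_morphism.
HB.instance Definition _ := GRing.isMonoidMorphism.Build R B (br_const D)
  br_const_is_monoid_morphism.

(** A term of y x in degree 0 pairs degree - a of y with degree a of x, which
    moves the coefficient of x back by sigma^(-a), hence into m. *)
Lemma br_coef0M_ideal m y x : ideal m ->
  (forall a, (sigmaX D a @` m) (br_coef x a)) -> m (br_coef (y * x) 0).
Proof.
move=> mI mx; rewrite br_coefM; apply: ideal_sum => // a _.
apply: ideal_sum => // b _; case: eqP => [/eqP|_]; last by case: mI.
rewrite addr_eq0 => /eqP ->; rewrite mulr1n; apply: scale_ideal => //.
by case: (mI) => _ _; apply; apply/sigmaX_imageE.
Qed.

End Homogeneous.
(** * Weight vectors and simple modules *)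

Section WeightSpaces.
Variables (k : fieldType) (R : comAlgType k) (n : nat) (D : brDatum R n).
Variable M : lmodType (brAlgebra D).
Implicit Types (m : set R) (a b : multideg n) (v w : M).

(** Elements outside m act invertibly on weight m. *)
Lemma weight_scale_eq0 m r v : maximal_ideal m -> weight_space m v -> ~ m r ->
  br_const D r *: v = 0 -> v = 0.
Proof.
move=> mm mv /(maximal_bezout mm)[q /mv mq] rv.
move: mq; rewrite rmorphB rmorph1 rmorphM scalerBl scale1r -scalerA rv.
by rewrite scaler0 subr0.
Qed.

Lemma weight_fix m r v : maximal_ideal m -> weight_space m v -> v != 0 ->
  br_const D r *: v = v -> ~ m r.
Proof. by move=> mm mv v0 rv /mv; rewrite rv; apply/eqP. Qed.

(** Independence of weight spaces, in a form that also allows the sum to be a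
    weight vector instead of zero. An element of m and of all mu j with j <> i,
    but outside mu i, kills the sum and every summand except w i. *)
Lemma weight_indep (T : eqType) (s : seq T) (mu : T -> set R) (w : T -> M) m :
    uniq s -> {in s &, injective mu} ->
    (forall i, i \in s -> maximal_ideal (mu i) /\ weight_space (mu i) (w i)) ->
    maximal_ideal m -> weight_space m (\sum_(i <- s) w i) ->
  forall i, i \in s -> mu i <> m -> w i = 0.
Proof.
move=> us muI muP mm msum i si neq.
have [mui wi] := muP i si.
have [|r ri rP] := @maximal_avoid R _ (None :: [seq Some j | j <- s & j != i])
  (fun o => if o is Some j then mu j else m) _ mui.
  move=> [j|_]; last by split=> // /esym.
  rewrite inE /= (mem_map Some_inj) mem_filter => /andP[ji sj].
  split; first by case: (muP j sj).
  by move=> /muI => /(_ sj si) /eqP; apply/negP.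
apply: (weight_scale_eq0 mui wi ri).
have := msum r (rP None (mem_head _ _)).
rewrite (bigD1_seq i) //= scalerDr scaler_sumr big_seq_cond big1 ?addr0 //.
move=> j /andP[sj ji]; have [_ wj] := muP j sj; apply: wj.
by apply: (rP (Some j)); rewrite inE /= (mem_map Some_inj) mem_filter ji.
Qed.

(** Since t^a s = sigma^a(s) t^a. *)
Lemma weight_term m x a v : weight_space m v ->
  weight_space (sigmaX D a @` m) (br_term x a *: v).
Proof.
by move=> mv _ [s ms <-]; rewrite scalerA br_const_term -scalerA mv ?scaler0.
Qed.

End WeightSpaces.

Section TorsionFreeWeights.
Variables (k : fieldType) (R : comAlgType k) (n : nat) (D : brDatum R n).
Variable O : set (set R).
Hypotheses (O_orbit : is_orbit D O) (O_free : torsion_free D O).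
Local Notation B := (brAlgebra D).
Local Notation S := (skewLaurent D).
Implicit Types (M N : lmodType B) (m : set R) (a b : multideg n) (x y : B).

(** The terms x_b t^b v lie in the distinct weights sigma^b(m), so only the one of
    the weight of x v survives. *)
Lemma weight_component M m a x (v : M) : O m -> weight_space m v ->
  weight_space (sigmaX D a @` m) (x *: v) -> x *: v = br_term x a *: v.
Proof.
move=> Om mv; rewrite {1 2}[x]br_sum_terms scaler_suml => xav.
have comp0 : forall b, b \in (msupp (val x : S) : seq _) -> b != a ->
    br_term x b *: v = 0.
  move=> b xb ba; apply: (weight_indep (mu := fun c => sigmaX D c @` m) _ _ _ _ xav xb).
  - exact: fset_uniq.
  - by move=> ? ? _ _; apply: (orbit_inj O_free Om).
  - move=> c _; split; last exact: weight_term.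
    exact/(orbit_maximal O_orbit)/(orbit_sigmaX O_orbit).
  - exact/(orbit_maximal O_orbit)/(orbit_sigmaX O_orbit).
  - by move/(orbit_inj O_free Om)/eqP; apply/negP.
have [xa|xa] := boolP (a \in (msupp (val x : S) : seq _)).
  rewrite (bigD1_seq a) ?fset_uniq //= big_seq_cond big1 ?addr0 //.
  by move=> b /andP[]; apply: comp0.
rewrite big_seq big1 => [|b xb]; last by apply: comp0 => //; apply: contraNneq xa => <-.
have -> : br_term x a = 0; last by rewrite scale0r.
by apply: val_inj; rewrite /= /br_coef mcoeff_outdom // monalgU0.
Qed.

(** The component of degree 0 is a scalar of R, by [br_term0]. *)
Lemma weight_component0 M m x (v : M) : O m -> weight_space m v ->
  weight_space m (x *: v) -> x *: v = br_const D (br_coef x 0) *: v.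
Proof.
move=> Om mv xv; rewrite -br_term0; apply: (weight_component Om) => //.
by rewrite sigmaX_image0.
Qed.

Lemma simple_cyclic M (v w : M) : simple_module M -> v != 0 ->
  exists x, w = x *: v.
Proof.
move=> [_ Msimple] v0; pose N : {pred M} := [pred w | `[< exists x : B, w = x *: v >]].
have [] := Msimple N.
- split; first by apply/asboolP; exists 0; rewrite scale0r.
  move=> b _ _ /asboolP[x ->] /asboolP[y ->]; apply/asboolP.
  by exists (b * x + y); rewrite scalerDl scalerA.
- move=> /(_ v) vE; case/eqP: v0; apply: vE.
  by apply/asboolP; exists 1; rewrite scale1r.
- by move=> /(_ w)/asboolP.
Qed.

(** The largest left ideal of B all of whose elements have their degree 0
    coefficient in m. *)
Definition weight_annihilator m : {pred B^o} :=
  [pred x : B | `[< forall y : B, m (br_coef (y * x) 0) >]].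

(** If x v = 0 then (y x)_0 v = y x v = 0, so (y x)_0 is in m. If x v <> 0, then
    y x v = v for some y, so (y x)_0 fixes v and is not in m. *)
Lemma simple_annihilator M m (v : M) x : simple_module M -> O m ->
  weight_space m v -> v != 0 -> (x *: v = 0 <-> x \in weight_annihilator m).
Proof.
move=> Msimple Om mv v0; have mm := orbit_maximal O_orbit Om; split=> [xv|].
  apply/asboolP => y; apply: contrapT => mc; case/eqP: v0.
  have yxv : (y * x) *: v = 0 by rewrite -scalerA xv scaler0.
  apply: (weight_scale_eq0 mm mv mc); rewrite -(weight_component0 Om) //.
  by rewrite yxv => r _; rewrite scaler0.
move=> /asboolP xN; apply/eqP; apply: contrapT => /negP xv.
have [y vE] := simple_cyclic v Msimple xv.
have := xN y; apply: (weight_fix mm mv v0).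
rewrite -(weight_component0 Om) // -scalerA -vE //.
Qed.

(** Both modules are generated by the given vectors, whose annihilators coincide;
    the isomorphism is x v |-> x w. *)
Lemma simple_isomorphic M N m (v : M) (w : N) : simple_module M ->
    simple_module N -> O m -> weight_space m v -> v != 0 ->
  weight_space m w -> w != 0 -> isomorphic M N.
Proof.
move=> Ms Ns Om mv v0 mw w0.
have annE x y : x *: v = y *: v <-> x *: w = y *: w.
  have aux : x *: v - y *: v = 0 <-> x *: w - y *: w = 0.
    rewrite -!scalerBl (simple_annihilator _ Ms Om mv v0).
    by rewrite (simple_annihilator _ Ns Om mw w0).
  by split=> /eqP; rewrite -subr_eq0 => /eqP/aux/subr0_eq.
have /choice[c cE] u := simple_cyclic u Ms v0.
have /choice[d dE] u := simple_cyclic u Ns w0.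
pose f u : N := c u *: w.
have f_lin : linear f.
  move=> b u u'; rewrite /f scalerA -scalerDl; apply/annE.
  by rewrite scalerDl -scalerA -!cE.
pose F : {linear M -> N} := HB.pack f (GRing.isLinear.Build _ _ _ _ f f_lin).
exists F; exists (fun u => d u *: v) => u /=.
  by rewrite [RHS]cE; apply/annE; rewrite -dE.
by rewrite [RHS]dE; apply/annE; rewrite -cE.
Qed.

(** The condition that B_{-a} B_a is not contained in m: the weight sigma^a(m) can
    then be reached from m and left again towards m. *)
Definition linked m a := exists u w,
  [/\ br_coeffs D (- a) u, br_coeffs D a w & ~ m (u * sigmaX D (- a) w)].

(** Going from v to weight sigma^a(m) and back to v uses only the components of
    degree a and - a, whose product is then outside m. Conversely such a product
    acts invertibly on v, so the intermediate vector is nonzero. *)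
Lemma simple_supp M m : simple_module M -> in_wmod O M -> supp M m ->
  supp M = [set sigmaX D a @` m | a in linked m].
Proof.
move=> Ms [_ MO] mM; have Om := MO _ mM; have [mm [v mv v0]] := mM.
apply/seteqP; split=> [m'|_ [a [u [w [ua wa uw]]] <-]].
  move=> m'M; have [mm' [v' mv' v0']] := m'M.
  have [a m'E] := orbit_trans O_orbit Om (MO _ m'M); rewrite {}m'E in m'M mm' mv' *.
  exists a => //; have [x xE] := simple_cyclic v' Ms v0.
  have xa : v' = br_term x a *: v.
    by rewrite xE; apply: (weight_component Om) => //; rewrite -xE.
  have [y yE] := simple_cyclic v Ms v0'.
  have ya : v = br_term y (- a) *: v'.
    rewrite [LHS]yE; apply: (weight_component (orbit_sigmaX O_orbit _ Om) mv').
    by rewrite -yE sigmaX_imageD addNr sigmaX_image0.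
  exists (br_coef y (- a)), (br_coef x a); split; do ?exact: br_coefP.
  move=> /(scale_ideal (skew_coef D (- a) a)) muw.
  have : (br_term y (- a) * br_term x a) *: v = v by rewrite -scalerA -xa -ya.
  by rewrite br_monoM => /(weight_fix mm mv v0); apply; apply: muw; case: mm.
split; first exact/(orbit_maximal O_orbit)/(orbit_sigmaX O_orbit).
exists (br_mono wa *: v).
  have -> : br_mono wa = br_term (br_mono wa) a.
    by apply: val_inj; rewrite /= /br_coef /= mcoeffUU.
  exact: weight_term.
apply/eqP => wv; case/eqP: v0.
apply: (weight_scale_eq0 (r := skew_coef D (- a) a *: (u * sigmaX D (- a) w)) mm mv).
  by move=> /scale_idealE; case: mm => mI _ _ /(_ mI (skew_coef_neq0 _ _ _)).
by rewrite -br_monoM -scalerA wv scaler0.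
Qed.

End TorsionFreeWeights.
(** * A simple module through each point of the orbit *)

Section SimpleQuotient.
Variables (k : fieldType) (R : comAlgType k) (n : nat) (D : brDatum R n).
Variable O : set (set R).
Hypotheses (O_orbit : is_orbit D O) (O_free : torsion_free D O).
Local Notation B := (brAlgebra D).
Local Notation S := (skewLaurent D).
Implicit Types (m : set R) (a b : multideg n) (x y : B).

Lemma weight_annihilator_submod m : ideal m ->
  GRing.submod_closed (weight_annihilator (D := D) m).
Proof.
move=> [m0 mD mM]; split.
  by apply/asboolP => y; rewrite mulr0 /br_coef mcoeff0.
move=> b x x' /asboolP mx /asboolP mx'; apply/asboolP => y.
by rewrite mulrDr br_coefD; apply: mD => //; rewrite /= mulrA.
Qed.

Lemma weight_annihilator_coef m x : ideal m ->
  (forall a, (sigmaX D a @` m) (br_coef x a)) -> x \in weight_annihilator (D := D) m.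
Proof. by move=> mI mx; apply/asboolP => y; apply: br_coef0M_ideal. Qed.

(** The module is the quotient of B by the weight annihilator of m. For simplicity,
    a vector outside the kernel has a multiple z with z_0 outside m; an element
    of R lying in sigma^a(m) for all other degrees a of z, but not in m, turns it
    into a multiple congruent to an element of R outside m, from which the
    generator is recovered. *)
Lemma orbit_exists_simple m : O m -> exists M : lmodType B,
  [/\ simple_module M, in_wmod O M & supp M m].
Proof.
move=> Om; have mm := orbit_maximal O_orbit Om; have [mI m1 _] := mm.
have sXI a : ideal (sigmaX D a @` m).
  by case: (orbit_maximal O_orbit (orbit_sigmaX O_orbit a Om)).
have [M [p [p_surj p_eq]]] := submodule_quotient (weight_annihilator_submod mI).
have p0 x : p x = 0 <-> x \in weight_annihilator m.
  by rewrite -(raddf0 p) p_eq subr0.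
have pZ y x : y *: p x = p (y * x) by rewrite -linearZ.
have p1 : p 1 != 0.
  by apply/eqP => /p0/asboolP/(_ 1); rewrite mulr1 br_coef1 eqxx.
have p1m : weight_space m (p 1).
  move=> r mr; rewrite pZ mulr1; apply/p0/weight_annihilator_coef => // a.
  rewrite br_coef_const; have [->|_] := eqVneq a 0; last by case: (sXI a).
  by rewrite sigmaX_image0.
have p_sum x : p x = \sum_(a <- msupp (val x : S)) p (br_term x a).
  by rewrite {1}[x]br_sum_terms raddf_sum.
have p_term x a : weight_space (sigmaX D a @` m) (p (br_term x a)).
  by rewrite -[br_term x a]mulr1 -pZ; apply: weight_term.
exists M; split; last by split=> //; exists (p 1).
- split; first by exists (p 1).
  move=> P [P0 PZ]; have PB y v : v \in P -> y *: v \in P.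
    by move=> Pv; rewrite -[_ *: _]addr0; apply: PZ.
  have [[v Pv v0]|nP] := pselect (exists2 v, v \in P & v <> 0); last first.
    by left=> v Pv; apply: contrapT => v0; apply: nP; exists v.
  right; suff P1 : p 1 \in P.
    by move=> w; have [x ->] := p_surj w; rewrite -[x]mulr1 -pZ; apply: PB.
  have [x vE] := p_surj v; rewrite {}vE in Pv v0.
  have [y ny] : exists y, ~ m (br_coef (y * x) 0).
    apply: contrapT => ny; apply/v0/p0/asboolP => y.
    by apply: contrapT => my; apply: ny; exists y.
  have {Pv} : p (y * x) \in P by rewrite -pZ; apply: PB.
  move: (y * x) ny => {x y v0} z nz Pz.
  have [|r nr rP] := @maximal_avoid R _ [seq a <- msupp (val z : S) | a != 0]
    (fun a => sigmaX D a @` m) _ mm.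
    move=> a; rewrite mem_filter => /andP[a0 _]; split.
      exact/(orbit_maximal O_orbit)/(orbit_sigmaX O_orbit).
    by move=> /(O_free Om); apply/eqP.
  have [|q mq] := maximal_bezout (r := r * br_coef z 0) mm.
    by move=> /(maximal_prime mm)[].
  have -> : p 1 = br_const D (q * r) *: p z; last exact: PB.
  rewrite pZ; apply/p_eq/weight_annihilator_coef => // a.
  rewrite br_coefB br_coef1 br_coef_constM.
  have [->|a0] := eqVneq a 0; first by rewrite sigmaX_image0 -mulrA.
  rewrite mulr0n sub0r; apply: idealN => //.
  case: (sXI a) => I0 _ IM; have [za|za] := boolP (a \in (msupp (val z : S) : seq _)).
    by rewrite mulrAC; apply: IM; apply: rP; rewrite mem_filter a0.
  by rewrite /br_coef mcoeff_outdom // mulr0.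
have pt_max a : maximal_ideal (sigmaX D a @` m).
  exact/(orbit_maximal O_orbit)/(orbit_sigmaX O_orbit).
split; first split.
- move=> v; have [x ->] := p_surj v.
  pose deg m' := xget 0 [set a | m' = sigmaX D a @` m].
  have degK a : deg (sigmaX D a @` m) = a.
    apply: xget_unique => // b /(orbit_inj O_free Om); exact: esym.
  exists [seq sigmaX D a @` m | a <- msupp (val x : S)],
    (fun m' => p (br_term x (deg m'))).
  split; last by rewrite big_map p_sum; apply: eq_bigr => a _; rewrite degK.
    by rewrite (map_inj_uniq (orbit_inj O_free Om)) fset_uniq.
  by move=> _ /mapP[a _ ->]; rewrite degK.
- move=> s w us sP sw0 i si.
  have [|r ri rP] := @maximal_avoid R _ [seq j <- s | j != i] id i (sP i si).1.
    move=> j; rewrite mem_filter => /andP[/eqP ji /sP[] //].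
  apply: (weight_scale_eq0 (sP i si).1 (sP i si).2 ri).
  have := congr1 ( *:%R (br_const D r)) sw0.
  rewrite scaler0 scaler_sumr (bigD1_seq i) //= big_seq_cond big1 ?addr0 //.
  move=> j /andP[sj ji].
  by apply: (sP j sj).2; apply: rP; rewrite mem_filter ji.
- move=> m' [mm' [v mv /eqP v0]]; apply: contrapT => nO; apply: v0.
  have [x vE] := p_surj v; rewrite vE p_sum in mv *.
  apply: big1_seq => a /andP[_ xa].
  apply: (weight_indep (mu := fun c => sigmaX D c @` m) _ _ _ mm' mv xa).
  + exact: fset_uniq.
  + by move=> ? ? _ _; apply: (orbit_inj O_free Om).
  + by move=> c _; split.
  + by move=> E; apply: nO; rewrite -E; apply: orbit_sigmaX.
Qed.

End SimpleQuotient.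
(** * Breaks as sets of integers *)

Lemma int_least (P : int -> Prop) z y : z <= y -> P y ->
  exists u, [/\ z <= u, P u & forall w, z <= w < u -> ~ P w].
Proof.
move=> zy Py; pose Q : pred nat := fun l => `[< P (z + l%:Z) >].
have exQ : exists l, Q l.
  by exists `|y - z|%N; apply/asboolP; have -> : z + `|y - z|%N%:Z = y by lia.
exists (z + (ex_minn exQ)%:Z); case: ex_minnP => l /asboolP Pl minl.
split=> //; first by lia.
move=> w /andP[zw wl] Pw.
have /minl : Q `|w - z|%N.
  by apply/asboolP; have -> : z + `|w - z|%N%:Z = w by lia.
lia.
Qed.

Lemma int_greatest (P : int -> Prop) z y : y <= z -> P y ->
  exists u, [/\ u <= z, P u & forall w, u < w <= z -> ~ P w].
Proof.
move=> yz Py; have [||u [zu Pu minu]] := @int_least (fun w => P (- w)) (- z) (- y).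
- by lia.
- by rewrite opprK.
exists (- u); split=> // [|w uwz Pw]; first by lia.
by apply: (minu (- w)); [lia|rewrite opprK].
Qed.

Section LatticeModel.
Variables (k : fieldType) (R : comAlgType k) (n : nat) (D : brDatum R n).
Variables (O : set (set R)) (m0 : set R).
Hypotheses (O_orbit : is_orbit D O) (O_free : torsion_free D O) (Om0 : O m0).
Implicit Types (a b : multideg n) (i j : 'I_n) (y z w : int).
Implicit Types (e : extended (set (set R))).

(** The base point m0 identifies the orbit with Z^n. *)
Definition pt a : set R := sigmaX D a @` m0.

Definition axis i z : multideg n := [ffun j => if j == i then z else 0].

Lemma axisE i z j : axis i z j = if j == i then z else 0.
Proof. exact: ffunE. Qed.

Lemma multideg0 i : (0 : multideg n) i = 0.
Proof. exact: ffunE. Qed.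

Lemma multidegD a b i : (a + b) i = a i + b i.
Proof. exact: ffunE. Qed.

Lemma multidegN a i : (- a) i = - a i.
Proof. exact: ffunE. Qed.

Definition multidegE := (multideg0, multidegD, multidegN, axisE).

Lemma pt_in a : O (pt a).
Proof. exact: orbit_sigmaX. Qed.

Lemma pt_maximal a : maximal_ideal (pt a).
Proof. exact/(orbit_maximal O_orbit)/pt_in. Qed.

Lemma pt_inj : injective pt.
Proof. by move=> a b; apply: (orbit_inj O_free Om0). Qed.

Lemma pt_surj m : O m -> exists a, m = pt a.
Proof. exact: (orbit_trans O_orbit). Qed.

Lemma ptD a b : sigmaX D a @` pt b = pt (a + b).
Proof. exact: sigmaX_imageD. Qed.

Lemma sigmaX_fix i a (I : set R) : a i = 0 ->
  (forall j, j != i -> sd_sigma D j @` I = I) -> sigmaX D a @` I = I.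
Proof.
move=> ai fixI; rewrite /sigmaX; elim: (enum _) => [|j s IHs] /=.
  exact: image_id.
rewrite -[RHS](_ : sigmaz D j (a j) @` I = I); last first.
  have [->|ji] := eqVneq j i; first by rewrite ai; apply: image_id.
  exact/sigmaz_image_fix/fixI.
by rewrite -[in RHS]IHs [RHS]image_comp.
Qed.

(** The coordinates of a other than a_i act through the sigma_j with j <> i, which
    fix I. *)
Lemma sub_pt_axis i a (I : set R) : (forall j, j != i -> sd_sigma D j @` I = I) ->
  I `<=` pt a <-> I `<=` pt (axis i (a i)).
Proof.
move=> fixI; pose b := a - axis i (a i).
have bi : b i = 0 by rewrite !multidegE eqxx subrr.
have -> : pt a = sigmaX D b @` pt (axis i (a i)) by rewrite ptD subrK.
by rewrite -{1}(sigmaX_fix bi fixI) sigmaX_sub.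
Qed.

Lemma sub_pt_shift i z a (I : set R) :
    (forall j, j != i -> sd_sigma D j @` I = I) ->
  sigmaz D i z @` I `<=` pt a <-> I `<=` pt (axis i (a i - z)).
Proof.
move=> fixI.
have -> : sigmaz D i z @` I = sigmaX D (axis i z) @` I.
  by apply: eq_imagel => r _; rewrite sigmaX_single.
have -> : pt a = sigmaX D (axis i z) @` pt (a - axis i z) by rewrite ptD addrC subrK.
by rewrite sigmaX_sub (sub_pt_axis _ fixI) !multidegE eqxx.
Qed.

(** Only points on the axis of direction i are tested; by [sub_pt_axis] this
    decides the inclusion at every point with coordinate z in direction i. *)
Definition J_at i z := br_J D i `<=` pt (axis i z).
Definition H_at i z := br_H D i `<=` pt (axis i z).

(** Both signs of z are covered, as one of the two ranges is always empty. *)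
Lemma br_I_sub_pt i z a : br_I D i z `<=` pt a <->
  exists y, (a i - z < y <= a i /\ J_at i y) \/ (a i < y <= a i - z /\ H_at i y).
Proof.
have fixJ j : j != i -> sd_sigma D j @` br_J D i = br_J D i by exact: br_sigmaJ.
have fixH j : j != i -> sd_sigma D j @` br_H D i = br_H D i by exact: br_sigmaH.
have [l [->|->]] : exists l : nat, z = l%:Z \/ z = - l%:Z.
- by case: z => l; [exists l; left | exists l.+1; right].
- rewrite br_I_pos (ideal_prod_maximal _ (pt_maximal a)); split.
    move=> [_ /mapP[q + ->]]; rewrite mem_iota add0r => ql /(sub_pt_shift _ _ fixJ) Jq.
    by exists (a i - q%:Z); left; split=> //; lia.
  move=> [y [[yP Jy]|[yP _]]]; last by lia.
  exists (sigmaz D i (0 + `|a i - y|%N%:Z) @` br_J D i).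
    by apply: map_f; rewrite mem_iota; lia.
  apply/(sub_pt_shift _ _ fixJ); rewrite -/(J_at _ _).
  by have -> : a i - (0 + `|a i - y|%N%:Z) = y by lia.
- rewrite br_I_neg (ideal_prod_maximal _ (pt_maximal a)); split.
    move=> [_ /mapP[q + ->]]; rewrite mem_iota => ql /(sub_pt_shift _ _ fixH) Jq.
    by exists (a i - (0 - q.+1%:Z)); right; split=> //; lia.
  move=> [y [[yP _]|[yP Hy]]]; first by lia.
  exists (sigmaz D i (0 - (`|(y - a i - 1)%R|%N).+1%:Z) @` br_H D i).
    by apply: map_f; rewrite mem_iota; lia.
  apply/(sub_pt_shift _ _ fixH); rewrite -/(H_at _ _).
  by have -> : a i - (0 - (`|(y - a i - 1)%R|%N).+1%:Z) = y by lia.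
Qed.

Lemma br_coeffs_sub_pt a b :
  br_coeffs D a `<=` pt b <-> exists i, br_I D i (a i) `<=` pt b.
Proof.
rewrite br_coeffsE (ideal_prod_maximal _ (pt_maximal b)); split.
  by move=> [_ /mapP[i _ ->] sub]; exists i.
move=> [i sub]; exists (br_I D i (a i)) => //.
by apply: (map_f (fun i => br_I D i (a i))); rewrite mem_enum.
Qed.

(** The shift by 1 is the one in the notion of break: m is an i-break when
    sigma_i(m) contains H_i J_i. *)
Definition break_at i z := H_at i (z + 1) \/ J_at i (z + 1).

Lemma breaks_pt i a : breaks D O i (pt a) <-> break_at i (a i).
Proof.
have -> : break_at i (a i) <->
    br_H D i `<=` pt (axis i 1 + a) \/ br_J D i `<=` pt (axis i 1 + a).
  rewrite (sub_pt_axis _ (i := i)); last by move=> j; apply: br_sigmaH.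
  rewrite (sub_pt_axis _ (i := i) (I := br_J D i)); last by move=> j; apply: br_sigmaJ.
  by rewrite !multidegE eqxx addrC.
rewrite -(ideal_mul_maximal _ _ (pt_maximal _)) -ptD.
have -> : sigmaX D (axis i 1) @` pt a = sd_sigma D i @` pt a.
  by apply: eq_imagel => r _; rewrite sigmaX_single.
by split=> [[]|]; last by split; first exact: pt_in.
Qed.

(** For a_i > 0 the ideal in degree - a_i contributes the H_i, and the one in
    degree a_i the J_i, at the same coordinates 1, ..., a_i; for a_i < 0 the
    roles are exchanged, at the coordinates a_i + 1, ..., 0. Together they test
    H_i J_i at each step between m0 and sigma^a(m0). *)
Lemma linkedP a : linked D m0 a <->
  forall i z, (0 <= z < a i) || (a i <= z < 0) -> ~ break_at i z.
Proof.
have -> : linked D m0 a <->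
    ~ (br_coeffs D (- a) `<=` pt 0) /\ ~ (br_coeffs D a `<=` pt a).
  rewrite /pt sigmaX_image0; split=> [[u [w [ua wa nuw]]]|[nu nw]].
    have [[_ _ mM] _ _] := orbit_maximal O_orbit Om0.
    split=> [/(_ u ua) mu|/(_ w wa)/sigmaX_imageE mw]; apply: nuw; last exact: mM.
    by rewrite mulrC; apply: mM.
  have /existsNP[u /not_implyP[ua mu]] := nu;
    have /existsNP[w /not_implyP[wa mw]] := nw.
  exists u, w; split=> // /(maximal_prime (orbit_maximal O_orbit Om0))[//|].
  by move/sigmaX_imageE.
rewrite !br_coeffs_sub_pt; split=> [[nm np] i z zP bz|nb].
  have Hz : H_at i (z + 1) -> False.
    move=> Hz; have [z0|z0] := leP 0 z.
      by apply: nm; exists i; apply/br_I_sub_pt; exists (z + 1); right;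
        rewrite !multidegE; split=> //; lia.
    by apply: np; exists i; apply/br_I_sub_pt; exists (z + 1); right; split=> //; lia.
  have Jz : J_at i (z + 1) -> False.
    move=> Jz; have [z0|z0] := leP 0 z.
      by apply: np; exists i; apply/br_I_sub_pt; exists (z + 1); left; split=> //; lia.
    by apply: nm; exists i; apply/br_I_sub_pt; exists (z + 1); left;
      rewrite !multidegE; split=> //; lia.
  by case: bz.
split=> -[i /br_I_sub_pt[y yP]]; apply: (nb i (y - 1)); rewrite /break_at ?subrK;
  move: yP; rewrite ?multidegE => -[] [yP vy]; by [lia|left|right].
Qed.

(** A Gamma_i-orbit in the coordinates of the base point. *)
Definition layer i z : set (set R) := [set pt b | b in [set b : multideg n | b i = z]].

Lemma layer_pt i z a : layer i z (pt a) <-> a i = z.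
Proof. by split=> [[b bi /pt_inj <-]|ai]; last by exists a. Qed.

Lemma layer_inj i : injective (layer i).
Proof.
move=> z w zw; have : layer i z (pt (axis i z)) by apply/layer_pt;
  rewrite !multidegE eqxx.
by rewrite zw => /layer_pt; rewrite !multidegE eqxx.
Qed.

Lemma Gamma_orbit_pt i a : Gamma_orbit D i (pt a) = layer i (a i).
Proof.
apply/seteqP; split=> [_ [b bi <-]|_ [b bi <-]].
  by rewrite ptD; apply/layer_pt; rewrite !multidegE bi add0r.
by exists (b - a); rewrite ?ptD ?subrK //= !multidegE bi subrr.
Qed.

Lemma prec_pt i a b : prec D i (pt a) (pt b) <-> exists2 z, 0 < z & b = axis i z + a.
Proof.
have step m : sd_sigma D i @` m = sigmaX D (axis i 1) @` m.
  by apply: eq_imagel => r _; rewrite sigmaX_single.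
have axisD z w : axis i z + axis i w = axis i (z + w).
  by apply/ffunP => j; rewrite !multidegE; case: eqP => _; rewrite ?addr0.
split=> [|[z z0 ->]].
  suff aux m m' : prec D i m m' ->
      exists2 z, 0 < z & m' = sigmaX D (axis i z) @` m.
    by case/aux => z z0; rewrite ptD => /pt_inj; exists z.
  elim=> {m m'} [m m' ->|m m1 m2 _ [z z0 ->] _ [w w0 ->]]; first by exists 1.
  by exists (w + z); rewrite ?sigmaX_imageD ?axisD //; lia.
have [l ->] : exists l : nat, z = l.+1%:Z by exists `|(z - 1)%R|%N; lia.
elim: l => [|l IHl]; first by apply: Relation_Operators.t_step; rewrite step ptD.
apply: Relation_Operators.t_trans IHl _; apply: Relation_Operators.t_step.
by rewrite step ptD addrA axisD; congr (pt (axis i _ + a)); lia.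
Qed.

Lemma class_prec_layer i z w : class_prec D i (layer i z) (layer i w) <-> z < w.
Proof.
split=> [[_ [_ [[a az <-] [b bw <-] /prec_pt[y y0 bE]]]]|zw].
  by move: bw; rewrite bE /= !multidegE eqxx -az /=; lia.
exists (pt (axis i z)), (pt (axis i w)); split.
- by apply/layer_pt; rewrite !multidegE eqxx.
- by apply/layer_pt; rewrite !multidegE eqxx.
apply/prec_pt; exists (w - z); first by lia.
by apply/ffunP => j; rewrite !multidegE; case: eqP => _; rewrite ?subrK ?addr0.
Qed.

Lemma ext_prec_elt_pt i z a : ext_prec_elt D i (Class (layer i z)) (pt a) <-> z < a i.
Proof.
split=> [[_ [b bz <-] /prec_pt[y y0 ->]]|za].
  by rewrite !multidegE eqxx -bz /=; lia.
exists (pt (axis i (z - a i) + a)); first by apply/layer_pt;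
  rewrite !multidegE eqxx subrK.
apply/prec_pt; exists (a i - z); first by lia.
by apply/ffunP => j; rewrite !multidegE; case: eqP => [->|_]; rewrite ?subrK ?add0r.
Qed.

Lemma elt_preceq_ext_pt i z a : elt_preceq_ext D i (pt a) (Class (layer i z)) <->
  a i <= z.
Proof.
split=> [[_ [b bz <-] [/pt_inj ->|/prec_pt[y y0 bE]]]|az].
- by rewrite bz.
- by rewrite -bz bE !multidegE eqxx; lia.
exists (pt (axis i (z - a i) + a)); first by apply/layer_pt;
  rewrite !multidegE eqxx subrK.
have [E|ne] := eqVneq z (a i).
  left; congr pt; apply/ffunP => j; rewrite !multidegE.
  by case: eqP => [->|_]; rewrite ?add0r // E subrr add0r.
by right; apply/prec_pt; exists (z - a i) => //; move/eqP: ne; lia.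
Qed.

Lemma break_classesP i c : break_classes D O i c <->
  exists2 z, break_at i z & c = layer i z.
Proof.
split=> [[m bm <-]|[z bz ->]].
  have [a mE] := pt_surj bm.1; rewrite {}mE in bm *.
  by exists (a i); [exact/breaks_pt|exact: Gamma_orbit_pt].
exists (pt (axis i z)); last by rewrite Gamma_orbit_pt !multidegE eqxx.
by apply/breaks_pt; rewrite !multidegE eqxx.
Qed.

(** Labels the interval between consecutive breaks around z by its upper end, as
    the break classes extended by infinity do. *)
Definition next_break i z e :=
  match e with
  | MinusInfty => False
  | Class c => exists y,
      [/\ c = layer i y, break_at i y, z <= y & forall w, z <= w < y -> ~ break_at i w]
  | PlusInfty => forall w, z <= w -> ~ break_at i w
  end.

Lemma next_break_unique i z e e' : next_break i z e -> next_break i z e' -> e = e'.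
Proof.
case: e => [|c|] //; case: e' => [|c'|] //.
- move=> [y [-> by_ zy ny]] [y' [-> by' zy' ny']]; congr (Class (layer i _)).
  have [yy'|y'y|//] := ltgtP y y'.
    by case: (ny' y) => //; rewrite zy.
  by case: (ny y') => //; rewrite zy'.
- by move=> [y [_ by_ zy _]] /(_ y zy).
- by move=> + [y [_ by_ zy _]] => /(_ y zy).
Qed.

(** When no break is at or above z, either there are no breaks at all or the breaks
    have a largest element, which are the two cases in which infinity is
    admitted. *)
Lemma next_break_ext i z e : next_break i z e -> ext_break_classes D O i e.
Proof.
case: e => //= [c [y [-> by_ _ _]]|nb]; first by apply/break_classesP; exists y.
have [[y by_]|nob] := pselect (exists y, break_at i y); last first.
  by left; rewrite -subset0 => c /break_classesP[y by_ _]; apply: nob; exists y.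
right; have yz : y <= z - 1 by rewrite leNgt; apply/negP => zy; apply: (nb y) => //;
  lia.
have [u [uz bu nu]] := int_greatest yz by_.
exists (layer i u); first by apply/break_classesP; exists u.
move=> _ /break_classesP[w bw ->] /class_prec_layer uw.
have [wz|zw] := ltP w z; last exact: (nb w).
by apply: (nu w) => //; lia.
Qed.

Lemma next_break_exists i z : exists e, next_break i z e.
Proof.
have [[y zy by_]|nb] := pselect (exists2 y, z <= y & break_at i y); last first.
  by exists PlusInfty => w zw bw; apply: nb; exists w.
by have [u [zu bu nu]] := int_least zy by_; exists (Class (layer i u)), u.
Qed.

Lemma next_break_total i e : ext_break_classes D O i e -> exists z, next_break i z e.
Proof.
case: e => //= [c /break_classesP[z bz ->]|[nb|[c /break_classesP[z bz ->] zmax]]].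
- by exists z, z; split=> // w; lia.
- exists 0 => w _ bw; have : break_classes D O i (layer i w) by apply/break_classesP;
    exists w.
  by rewrite nb.
- exists (z + 1) => w zw bw; apply: (zmax (layer i w)).
    by apply/break_classesP; exists w.
  by apply/class_prec_layer; lia.
Qed.

(** A second coordinate has the same next break iff no break separates the two; a
    coordinate that is itself a break belongs to the interval below it, hence the
    half-open ranges. *)
Lemma next_break_same i x y e : next_break i x e ->
  next_break i y e <-> (forall w, (x <= w < y) || (y <= w < x) -> ~ break_at i w).
Proof.
case: e => //= [c [u [-> bu xu nu]]|nx].
  split=> [[u' [/layer_inj <- _ yu nu'] w wP]|nb].
    by have [xw|wx] := leP x w; [apply: nu|apply: nu']; lia.
  exists u; split=> // [|w wP]; first by rewrite leNgt; apply/negP => uy;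
    apply: (nb u) => //; lia.
  by have [xw|wx] := leP x w; [apply: nu|apply: nb]; lia.
split=> [ny w wP|nb w yw]; have [xw|wx] := leP x w;
  [apply: nx|apply: ny|apply: nx|apply: nb]; lia.
Qed.

(** The predecessor of e is the largest break below e if there is a break below e,
    and minus infinity otherwise; so being above it means that no break lies in
    the range from a_i up to, but excluding, e. *)
Lemma next_breakP i a e : ext_break_classes D O i e ->
  ext_prec_elt D i (ext_pred D O i e) (pt a) /\ elt_preceq_ext D i (pt a) e <->
  next_break i (a i) e.
Proof.
move=> ext_e; set P := [set e' | [/\ ext_break_classes D O i e', ext_prec D i e' e
      & forall e'', ext_break_classes D O i e'' -> ext_prec D i e'' e ->
          e'' = e' \/ ext_prec D i e'' e']].
have predP u : break_at i u -> ext_prec D i (Class (layer i u)) e ->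
    (forall w, break_at i w -> u < w -> ~ ext_prec D i (Class (layer i w)) e) ->
    P (Class (layer i u)).
  move=> bu ue umax; split=> //=; first by apply/break_classesP; exists u.
  move=> [//|c|] /=; last by move=> _; case: (e).
  move=> /break_classesP[w bw ->] we; have [wu|uw|->] := ltgtP w u.
  - by right; apply/class_prec_layer.
  - by case: (umax w).
  - by left.
have pred_lt x :
    (forall w, break_at i w -> x <= w -> ~ ext_prec D i (Class (layer i w)) e) ->
    a i = x -> ext_prec_elt D i (ext_pred D O i e) (pt a).
  move=> nb ax; rewrite /ext_pred -/P; case: xgetP => [e' _ [ee pe _]|//].
  case: e' ee pe => //= c /break_classesP[w bw ->] we.
  apply/ext_prec_elt_pt; rewrite ltNge; apply/negP; rewrite ax => aw.
  exact: (nb w bw aw).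
(* A break y from a_i up to, but excluding, e forces the predecessor u of e to
   be at or above y, hence not below the point. *)
have pred_ge y u : a i <= y -> break_at i y -> y <= u -> break_at i u ->
    ext_prec D i (Class (layer i u)) e ->
    (forall w, break_at i w -> u < w -> ~ ext_prec D i (Class (layer i w)) e) ->
    ~ ext_prec_elt D i (ext_pred D O i e) (pt a).
  move=> ay by_ yu bu ue umax.
  have Pu := predP u bu ue umax; rewrite /ext_pred -/P.
  case: xgetP => [e' _ [ee pe e'max]|/(_ _ Pu)//].
  have uext : ext_break_classes D O i (Class (layer i u)) by apply/break_classesP;
    exists u.
  have := e'max _ uext ue; case: e' ee pe {e'max} => //= c.
  move=> /break_classesP[w bw ->] we uw /ext_prec_elt_pt wa.
  by case: uw => [[/layer_inj]|/class_prec_layer]; lia.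
clear P predP; case: e ext_e pred_lt pred_ge => //= [c|].
  move=> /break_classesP[z bz ->] pred_lt pred_ge.
  rewrite -[exists2 m', _ & _]/(elt_preceq_ext D i (pt a) (Class (layer i z))).
  rewrite elt_preceq_ext_pt.
  split=> [[pa az]|[_ [/layer_inj<- _ az nz]]]; last first.
    split=> //; apply: (pred_lt (a i)) => // w bw aw /class_prec_layer wz.
    by apply: (nz w) => //; lia.
  exists z; split=> // w /andP[aw wz] bw.
  have [|u [uz bu nu]] := @int_greatest (break_at i) (z - 1) w _ bw; first by lia.
  have wu : w <= u by rewrite leNgt; apply/negP => uw; apply: (nu w) => //; lia.
  apply: (pred_ge w u aw bw wu bu) pa; first by apply/class_prec_layer; lia.
  by move=> t bt ut /class_prec_layer tz; apply: (nu t) => //; lia.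
move=> ext_e pred_lt pred_ge; split=> [[pa _] w aw bw|na]; last first.
  by split=> //; apply: (pred_lt (a i)) => // w bw aw _; apply: (na w).
case: ext_e => [nb|[c /break_classesP[u bu ->] umax]].
  have : break_classes D O i (layer i w) by apply/break_classesP; exists w.
  by rewrite nb.
have below t : break_at i t -> t <= u.
  move=> bt; rewrite leNgt; apply/negP => ut; apply: (umax (layer i t)).
    by apply/break_classesP; exists t.
  exact/class_prec_layer.
apply: (pred_ge w u aw bw (below w bw) bu) pa => // t /below; lia.
Qed.

Lemma box_pt (e : 'I_n -> extended (set (set R))) a :
  (forall i, ext_break_classes D O i (e i)) ->
  box D O e (pt a) <-> forall i, next_break i (a i) (e i).
Proof.
move=> ext_e; split=> [[_ ea] i|nx]; first exact/next_breakP.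
by split=> [|i]; [exact: pt_in|apply/next_breakP].
Qed.

End LatticeModel.
(** * Supports are boxes *)

Section SupportsAreBoxes.
Variables (k : fieldType) (R : comAlgType k) (n : nat) (D : brDatum R n).
Variable O : set (set R).
Hypotheses (O_orbit : is_orbit D O) (O_free : torsion_free D O).
Local Notation B := (brAlgebra D).
Implicit Types (M N : lmodType B) (m : set R) (e f : 'I_n -> extended (set (set R))).

Let admissible e := forall i, ext_break_classes D O i (e i).

(** The base point can be taken to be the point itself, with coordinate 0. *)
Lemma box_next m e : O m -> admissible e ->
  box D O e m <-> forall i, next_break D m i 0 (e i).
Proof.
move=> Om ext_e; have := box_pt O_orbit O_free Om 0 ext_e.
rewrite /pt sigmaX_image0 => ->.
by split=> nx i; have := nx i; rewrite multideg0.
Qed.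

Lemma box_unique m e f : admissible e -> admissible f ->
  box D O e m -> box D O f m -> e = f.
Proof.
move=> ext_e ext_f em fm; have Om := em.1.
apply/funext => i; move/(box_next Om ext_e): em => /(_ i) em.
by move/(box_next Om ext_f): fm => /(_ i) /(next_break_unique em).
Qed.

Lemma box_exists m : O m -> exists2 e, admissible e & box D O e m.
Proof.
move=> Om; have /choice[e eP] i := next_break_exists D m i 0.
have ext_e : admissible e.
  by move=> i; apply: (next_break_ext O_orbit O_free Om (eP i)).
by exists e => //; apply/box_next.
Qed.

Lemma box_nonempty e : admissible e -> exists m, box D O e m.
Proof.
move=> ext_e; have Om1 : exists m, O m.
  have [m mm OE] := O_orbit; exists m; rewrite OE; exists 0 => //.
  exact: sigmaX_image0.
have [m Om] := Om1.
have /choice[a aP] i := next_break_total O_orbit O_free Om (ext_e i).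
exists (pt D m [ffun i => a i]); apply/(box_pt O_orbit O_free Om) => // i.
by rewrite ffunE.
Qed.

(** A point linked to m is one with the same next breaks as m. *)
Lemma simple_supp_box M m e : simple_module M -> in_wmod O M -> supp M m ->
  admissible e -> box D O e m -> supp M = box D O e.
Proof.
move=> Ms MO mM ext_e em; have Om := em.1.
rewrite (simple_supp O_orbit O_free Ms MO mM).
have boxE a : box D O e (pt D m a) <-> linked D m a.
  rewrite (box_pt O_orbit O_free Om _ ext_e) (linkedP O_orbit Om).
  move/(box_next Om ext_e): em => nx.
  by split=> [na i|nb i]; apply/(next_break_same O_free Om (a i) (nx i));
    [apply: na|apply: nb].
apply/seteqP; split=> [_ [a /boxE ea <-] //|m' em'].
have [a m'E] := orbit_trans O_orbit Om em'.1.
by exists a => //; apply/boxE; rewrite /pt -m'E.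
Qed.

Lemma simple_supp_nonempty M : simple_module M -> in_wmod O M -> exists m, supp M m.
Proof.
move=> [[v v0] _] [[wM _] _]; have [s [w [_ wP vE]]] := wM v.
apply: contrapT => nM; case/eqP: v0; rewrite vE big1_seq // => m /andP[_ ms].
apply/eqP; apply: contrapT => /negP w0; apply: nM; exists m.
by have [mm wm] := wP m ms; split=> //; exists (w m).
Qed.

Lemma isomorphic_supp M N : isomorphic M N -> supp M `<=` supp N.
Proof.
move=> [F /bij_inj F_inj] m [mm [v mv v0]]; split=> //; exists (F v).
  by move=> r mr; rewrite -linearZ mv ?raddf0.
by apply: contraNneq v0; rewrite -(raddf0 F) => /F_inj ->.
Qed.

End SupportsAreBoxes.

Theorem theorem3p9 (k : fieldType) (R : comAlgType k) (n : nat)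
    (D : brDatum R n) (O : set (set R)) :
  is_orbit D O -> torsion_free D O ->
  let simple_in_wmodO (M : lmodType (brAlgebra D)) :=
    simple_module M /\ in_wmod O M in
  let corresponds (M : lmodType (brAlgebra D))
      (e : 'I_n -> extended (set (set R))) :=
    (forall i, ext_break_classes D O i (e i)) /\ supp M = box D O e in
  [/\ forall M, simple_in_wmodO M -> exists! e, corresponds M e,
      forall M N e f, simple_in_wmodO M -> simple_in_wmodO N ->
        corresponds M e -> corresponds N f -> (isomorphic M N <-> e = f)
    & forall e, (forall i, ext_break_classes D O i (e i)) ->
        exists2 M, simple_in_wmodO M & corresponds M e].
Proof.
move=> O_orbit O_free simple_in_wmodO corresponds; split.
- move=> M [Ms MO]; have [m mM] := simple_supp_nonempty Ms MO.
  have [e ext_e em] := box_exists O_orbit O_free (MO.2 _ mM).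
  exists e; split; first by split=> //; apply: (simple_supp_box _ _ Ms MO mM).
  move=> f [ext_f fM]; apply: (box_unique O_orbit O_free _ _ em) => //.
  by rewrite -fM.
- move=> M N e f [Ms MO] [Ns NO] [ext_e eM] [ext_f fN]; split=> [MN|ef].
    have [m mM] := simple_supp_nonempty Ms MO.
    apply: (box_unique (m := m) O_orbit O_free) => //; first by rewrite -eM.
    by rewrite -fN; apply: (isomorphic_supp MN).
  have [m mM] := simple_supp_nonempty Ms MO.
  have mN : supp N m by rewrite fN -ef -eM.
  have [_ [v mv v0]] := mM; have [_ [w mw w0]] := mN.
  exact: (simple_isomorphic O_orbit O_free Ms Ns (MO.2 _ mM) mv v0 mw w0).
- move=> e ext_e; have [m em] := box_nonempty O_orbit O_free ext_e.
  have [M [Ms MO mM]] := orbit_exists_simple O_orbit O_free em.1.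
  by exists M => //; split=> //; apply: (simple_supp_box _ _ Ms MO mM).
Qed.
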